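(* For any natural number $n\ge 0$ and any pointed saturated complicial set $X$, there is an isomorphism of monoids $\tau_{n+1}(X)\cong\tau_n(\Omega(X))$.
   Context: **Simplicial sets with marking.** A simplicial set with marking is a pair $(X,mX)$ with $X$ a simplicial set and $mX$ a set of simplices of $X$ (the marked simplices) containing all degenerate simplices and no $0$-simplices. A map $(X,mX)\to(Y,mY)$ is a simplicial map $f:X\to Y$ with $f(mX)\subset mY$. The category is $\mathrm{msSet}$; $\mathrm{msSet}_*$ is the category of pointed objects (a chosen $0$-simplex) and pointed maps. A regular subset of $(Y,mY)$ is a simplicial subset $X\subset Y$ with $mX=X\cap mY$. $\Delta[n]$ carries only its degenerate simplices as marked; $\Delta[-1]$ is the empty one. **Standard objects.** Let $[n]=\{0,\dots,n\}$. $\Delta[n]_t$ is $\Delta[n]$ with, for $n\ge1$, the simplex $\mathrm{Id}_{[n]}$ also marked. $\Delta^k[n]$ is $\Delta[n]$ with marked simplices the degenerate ones and those $\alpha$ with $\{k-1,k,k+1\}\cap[n]\subset\mathrm{Im}(\alpha)$. $\Lambda^k[n]$ is the regular subset of $\Delta^k[n]$ on the usual $k$-th horn. $\Delta^k[n]''$ (resp. $\Lambda^k[n]'$) is obtained from $\Delta^k[n]$ (resp. $\Lambda^k[n]$) by marking also all of its $(n-1)$-simplices, and $\Delta^k[n]'=\Delta^k[n]\cup\Lambda^k[n]'$. $\Delta[3]_{eq}$ is $\Delta[3]$ with marked simplices the degenerate ones, all $2$- and $3$-simplices, and the edges $[02]$ and $[13]$. $\Delta[3]^\sharp$ is $\Delta[3]$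 with all simplices of dimension $\ge1$ marked. **Join.** $(X\star Y)_n=\coprod_{k,l\ge-1,\,k+l=n-1}X_k\times Y_l$ with $X_{-1},Y_{-1}$ one-point sets. For $(x,y)\in X_k\times Y_l$, $d_i(x,y)=(d_ix,y)$ and $s_i(x,y)=(s_ix,y)$ if $0\le i\le k$, while $d_i(x,y)=(x,d_{i-k-1}y)$ and $s_i(x,y)=(x,s_{i-k-1}y)$ if $k+1\le i\le k+l+1$. A simplex $(x,y)$ is marked iff $x$ is marked in $X$ or $y$ is marked in $Y$ (the elements of degree $-1$ are unmarked). **Saturated complicial sets.** Elementary anodyne extensions are: $\Lambda^k[m]\to\Delta^k[m]$ ($m\ge1$, $k\in[m]$); $\Delta^k[m]'\to\Delta^k[m]''$ ($m\ge2$, $k\in[m]$); $\Delta[m]\star\Delta[3]_{eq}\to\Delta[m]\star\Delta[3]^\sharp$ ($m\ge-1$). A saturated complicial set is a simplicial set with marking having the right lifting property with respect to all elementary anodyne extensions; a pointed one is one with a chosen $0$-simplex. **Loop space.** For a pointed $X$, let $x_\bot$ be the $0$-simplex of $\Delta[0]\star X$ from $\Delta[0]$, $x_\top$ the one from the base point of $X$, $x_\bot x_\top$ the (unmarked) $1$-simplex from $x_\bot$ to $x_\top$, and $\langle x_\bot x_\top\rangle\subset\Delta[0]\star X$ the marked simplicial subset it generates. The reduced suspension $\Sigma_+X$ is the pushout of $\Delta[0]\leftarrow(\Delta[-1]\star X)\cup\langle x_\bot x_\top\rangle\hookrightarrow\Delta[0]\star X$, pointed by the image of $x_\bot$. The loop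 space functor $\Omega:\mathrm{msSet}_*\to\mathrm{msSet}_*$ is the right adjoint of $\Sigma_+$. Explicitly, $\Omega(Z,a)$ is the pullback of $\Delta[0]\xrightarrow{a}Z\leftarrow\mathrm P^{\triangleleft}_a(Z)$, where $n$-simplices of $\mathrm P^{\triangleleft}_a(Z)$ are maps $\Delta[0]\star\Delta[n]\to Z$ sending the vertex of $\Delta[0]$ to $a$, marked when they extend to $\Delta[0]\star\Delta[n]_t$ (for $n\ge1$), and the map to $Z$ is restriction along $\Delta[n]\hookrightarrow\Delta[0]\star\Delta[n]$; the base point is the constant map at $a$. Thus an $n$-simplex of $\Omega(Z,a)$ is an $(n+1)$-simplex of $Z$ with initial vertex $a$ whose $0$-th face is the degenerate simplex on $a$, and $d_i^{\Omega(Z)}=d_{i+1}^Z$. If $X$ is a pointed saturated complicial set then so is $\Omega(X)$, so its homotopy monoids are defined. **Homotopy monoids.** Let $(X,x)$ be a pointed saturated complicial set; write $x$ also for every degenerate simplex on $x$. Let $X^x_n$ be the set of $n$-simplices of $X$ all of whose faces equal $x$ (for $n=0$, all $0$-simplices). For $\alpha,\beta\in X^x_n$ write $\alpha\sim\beta$ if there is a marked $(n+1)$-simplex $\omega$ with $d_n\omega=\alpha$, $d_{n+1}\omega=\beta$ and $d_i\omega=x$ for $0\le i\le n-1$. This is an equivalence relation and $\tau_n(X)=X^x_n/{\sim}$. For $n\ge1$, $\tau_n(X)$ is a monoid with unit $[x]$ and product $[\alpha][\beta]=[d_n\theta]$, where $\theta:\Delta^n[n+1]\to X$ is any extension of the horn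 $\Lambda^n[n+1]\to X$ with $d_i\theta=x$ for $0\le i\le n-2$, $d_{n-1}\theta=\alpha$, $d_{n+1}\theta=\beta$. For $n=0$, the set $\tau_0(\Omega(X))$ is given the monoid structure transported from $\tau_1(X)$ along the bijection $\tau_1(X)\to\tau_0(\Omega(X))$, $[\alpha]\mapsto[\alpha]$, where a $1$-simplex $\alpha\in X^x_1$ is regarded as a $0$-simplex of $\Omega(X)$. *)

(* Defs.v *)
From HB Require Import structures.
From mathcomp Require Import all_boot zify boolp.

Set Implicit Arguments.
Unset Strict Implicit.
Unset Printing Implicit Defensive.

#[local] Obligation Tactic := idtac.

(** * Monotone maps of finite ordinals *)

(* [mono m n] consists of the monotone maps {0,...,m-1} -> {0,...,n-1}.
   The arguments count vertices, so that a map [m] -> [n] of the simplex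
   category has type [mono m.+1 n.+1]; m = 0 and n = 0 are allowed and stand
   for the empty ordinal [-1]. *)
Definition monotone m n (f : {ffun 'I_m -> 'I_n}) : bool :=
  [forall i : 'I_m, forall j : 'I_m, (i <= j) ==> (f i <= f j)].

Record mono m n := Mono {
  mono_fun :> {ffun 'I_m -> 'I_n};
  mono_monotone : monotone mono_fun }.

HB.instance Definition _ m n := [isSub for @mono_fun m n].
HB.instance Definition _ m n := [Finite of mono m n by <:].

Lemma mono_le m n (f : mono m n) (i j : 'I_m) : i <= j -> f i <= f j.
Proof. by move=> h; have /forallP/(_ i)/forallP/(_ j)/implyP := mono_monotone f; apply. Qed.

Lemma mono_eq m n (f g : mono m n) : (forall i, f i = g i :> nat) -> f = g.
Proof. by move=> h; apply/val_inj/ffunP => i; apply/val_inj/h. Qed.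

Lemma monotone_finfun m n (f : 'I_m -> 'I_n) :
  (forall i j : 'I_m, i <= j -> f i <= f j) -> monotone (finfun f).
Proof.
by move=> h; apply/forallP => i; apply/forallP => j; apply/implyP => /h; rewrite !ffunE.
Qed.

Definition mk_mono m n (f : 'I_m -> 'I_n)
    (h : forall i j : 'I_m, i <= j -> f i <= f j) : mono m n :=
  Mono (monotone_finfun h).

Lemma mk_monoE m n (f : 'I_m -> 'I_n) h i : @mk_mono m n f h i = f i.
Proof. by rewrite /= ffunE. Qed.

Definition mono_id n : mono n n := @mk_mono n n id (fun _ _ => id).

Lemma mono_comp_subproof p m n (g : mono m n) (f : mono p m) (i j : 'I_p) :
  i <= j -> g (f i) <= g (f j).
Proof. by move=> h; do 2!apply: mono_le. Qed.

Definition mono_comp p m n (g : mono m n) (f : mono p m) : mono p n :=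
  mk_mono (mono_comp_subproof g f).

Lemma mono_idE n i : mono_id n i = i. Proof. exact: mk_monoE. Qed.

Lemma mono_compE p m n (g : mono m n) (f : mono p m) i :
  mono_comp g f i = g (f i).
Proof. exact: mk_monoE. Qed.

Lemma mono_comp1f m n (f : mono m n) : mono_comp (mono_id n) f = f.
Proof. by apply: mono_eq => i; rewrite mono_compE mono_idE. Qed.

Lemma mono_compf1 m n (f : mono m n) : mono_comp f (mono_id m) = f.
Proof. by apply: mono_eq => i; rewrite mono_compE mono_idE. Qed.

Lemma mono_compA q p m n (h : mono m n) (g : mono p m) (f : mono q p) :
  mono_comp h (mono_comp g f) = mono_comp (mono_comp h g) f.
Proof. by apply: mono_eq => i; rewrite !mono_compE. Qed.

Lemma coface_subproof n (i : 'I_n.+1) (j k : 'I_n) :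
  j <= k -> lift i j <= lift i k.
Proof. by move=> jk; rewrite /= leq_bump2. Qed.

(* The injection missing [i]. *)
Definition coface n (i : 'I_n.+1) : mono n n.+1 := mk_mono (coface_subproof i).

Lemma codegen_lt n (i : 'I_n) (j : 'I_n.+1) : unbump i j < n.
Proof. by rewrite /unbump; have := ltn_ord i; have := ltn_ord j; lia. Qed.

Lemma codegen_subproof n (i : 'I_n) (j k : 'I_n.+1) :
  j <= k -> Ordinal (codegen_lt i j) <= Ordinal (codegen_lt i k).
Proof. by move=> jk /=; rewrite /unbump; lia. Qed.

(* The surjection taking the value [i] twice. *)
Definition codegen n (i : 'I_n) : mono n.+1 n := mk_mono (codegen_subproof i).

Lemma cofaceE n (i : 'I_n.+1) j : coface i j = bump i j :> nat.
Proof. by rewrite mk_monoE. Qed.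

Lemma codegenE n (i : 'I_n) j : codegen i j = unbump i j :> nat.
Proof. by rewrite mk_monoE. Qed.

(* The list of vertices of a simplex of a standard simplex. *)
Definition vertices m n (f : mono m n) : seq nat := [seq (f i : nat) | i <- enum 'I_m].

Lemma vertices_nth m n (f : mono m n) (i : 'I_m) : nth 0 (vertices f) i = f i.
Proof. by rewrite (nth_map i) ?size_enum_ord // nth_ord_enum. Qed.

Lemma vertices_id n : vertices (mono_id n) = iota 0 n.
Proof.
by rewrite -[RHS]val_enum_ord /vertices; apply: eq_map => i; rewrite mono_idE.
Qed.

(** * Simplicial sets *)

Record sset := SSet {
  simplices :> nat -> Type;
  act : forall m n, mono m.+1 n.+1 -> simplices n -> simplices m;
  act_id : forall n (x : simplices n), act (mono_id n.+1) x = x;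
  act_comp : forall p m n (g : mono m.+1 n.+1) (f : mono p.+1 m.+1)
    (x : simplices n), act (mono_comp g f) x = act f (act g x) }.

Arguments act {s m n}.

Definition face (X : sset) n (i : 'I_n.+2) (x : X n.+1) : X n := act (coface i) x.
Definition degen (X : sset) n (i : 'I_n.+1) (x : X n) : X n.+1 := act (codegen i) x.

Definition degenerate (X : sset) n : X n -> Prop :=
  match n with
  | 0 => fun _ => False
  | n'.+1 => fun x => exists (i : 'I_n'.+1) (y : X n'), x = degen i y
  end.

(** * Simplicial sets with marking *)

Record msset := MSSet {
  msset_sset :> sset;
  marked : forall n, msset_sset n -> Prop;
  marked_degenerate : forall n (x : msset_sset n), degenerate x -> marked x;
  marked_pos : forall x : msset_sset 0, ~ marked x }.

Arguments marked {m n}.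

Record mshom (X Y : msset) := MSHom {
  mshom_fun :> forall n, X n -> Y n;
  mshom_act : forall m n (f : mono m.+1 n.+1) (x : X n),
    mshom_fun (act f x) = act f (mshom_fun x);
  mshom_marked : forall n (x : X n), marked x -> marked (mshom_fun x) }.

Arguments mshom_fun {X Y} _ n x.

Lemma mshom_eq (X Y : msset) (f g : mshom X Y) :
  (forall n x, f n x = g n x) -> f = g.
Proof.
case: f g => [f f1 f2] [g g1 g2] /= fg.
have E : f = g by apply: functional_extensionality_dep => n; apply/funext/fg.
by subst g; congr MSHom; apply: Prop_irrelevance.
Qed.

Definition mshom_id (X : msset) : mshom X X :=
  @MSHom X X (fun _ => id) (fun _ _ _ _ => erefl) (fun _ _ => id).

Program Definition mshom_comp (X Y Z : msset) (g : mshom Y Z) (f : mshom X Y) :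
  mshom X Z := @MSHom X Z (fun n x => g n (f n x)) _ _.
Next Obligation. by move=> X Y Z g f m n h x /=; rewrite !mshom_act. Qed.
Next Obligation. by move=> X Y Z g f n x h; do 2!apply: mshom_marked. Qed.

(* Only the degenerate simplices are marked. *)
Program Definition flat (X : sset) : msset :=
  @MSSet X (@degenerate X) (fun _ _ => id) _.
Next Obligation. by move=> X x []. Qed.

(* The simplices of positive dimension satisfying [P] are marked in addition. *)
Program Definition enlarge (X : msset) (P : forall n, X n -> Prop) : msset :=
  @MSSet X (fun n x => marked x \/ (0 < n /\ P n x)) _ _.
Next Obligation. by move=> X P n x h; left; apply: marked_degenerate. Qed.
Next Obligation. by move=> X P x [/marked_pos|[]]. Qed.

Definition enlarge_map (X : msset) (P Q : forall n, X n -> Prop)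
    (h : forall n (x : X n), @marked (enlarge P) n x -> @marked (enlarge Q) n x) :
  mshom (enlarge P) (enlarge Q) :=
  @MSHom (enlarge P) (enlarge Q) (fun _ => id) (fun _ _ _ _ => erefl) h.

Section RegularSubset.
Variables (Y : msset) (P : forall n, Y n -> Prop).
Hypothesis P_act : forall m n (f : mono m.+1 n.+1) (y : Y n),
  P y -> P (act f y).

Program Definition subsset : sset :=
  @SSet (fun n => {y : Y n | P y})
    (fun m n f y => exist _ (act f (sval y)) (P_act f (svalP y))) _ _.
Next Obligation.
by move=> n [y Py] /=; apply: eq_exist; rewrite act_id.
Qed.
Next Obligation.
by move=> p m n g f [y Py] /=; apply: eq_exist; rewrite act_comp.
Qed.

Program Definition regular_subset : msset :=
  @MSSet subsset (fun n y => marked (sval y)) _ _.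
Next Obligation.
case=> [|n] // [y Py] /= [i [[z Pz] e]].
by apply: marked_degenerate; exists i, z; case: e.
Qed.
Next Obligation. by move=> [y Py] /marked_pos. Qed.

Definition regular_subset_incl : mshom regular_subset Y :=
  @MSHom regular_subset Y (fun _ => sval) (fun _ _ _ _ => erefl) (fun _ _ => id).

End RegularSubset.

(** * Standard objects *)

(* The standard simplex on N vertices, that is Delta[N-1]; it is empty for
   N = 0. *)
Program Definition simplex_sset (N : nat) : sset :=
  @SSet (fun n => mono n.+1 N) (fun m n f x => mono_comp x f) _ _.
Next Obligation. by move=> N n x; apply: mono_compf1. Qed.
Next Obligation. by move=> N p m n g f x; apply: mono_compA. Qed.

Definition simplex (N : nat) : msset := flat (simplex_sset N).
Notation Delta n := (simplex n.+1).

Definition Delta_t (n : nat) : msset :=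
  @enlarge (Delta n) (fun m f => vertices f = iota 0 n.+1).

(* [k.-1 <= j <= k.+1] says that j belongs to {k-1, k, k+1}, also if k = 0. *)
Definition Delta_adm (n k : nat) : msset :=
  @enlarge (Delta n) (fun m f =>
    forall j : 'I_n.+1, k.-1 <= j <= k.+1 -> exists i, f i = j).

Definition in_horn (n k m : nat) (f : Delta_adm n k m) : Prop :=
  exists j : 'I_n.+1, j <> k :> nat /\ forall i, (f : mono _ _) i <> j.

Lemma in_horn_act n k p m (f : mono p.+1 m.+1) (x : Delta_adm n k m) :
  in_horn x -> in_horn (act f x).
Proof. by case=> j [jk h]; exists j; split=> // i; rewrite mono_compE. Qed.

Definition horn (n k : nat) : msset := regular_subset (@in_horn_act n k).

Definition horn_incl (n k : nat) : mshom (horn n k) (Delta_adm n k) :=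
  regular_subset_incl (@in_horn_act n k).

(* The decorations ' and '' are used for n >= 2. *)
Definition horn_prime (n k : nat) : msset :=
  @enlarge (horn n k) (fun m _ => m = n.-1).

Definition Delta_adm_prime (n k : nat) : msset :=
  @enlarge (Delta_adm n k) (fun m f =>
    exists2 g : horn_prime n k m, marked g & horn_incl n k m g = f).

Definition Delta_adm_second (n k : nat) : msset :=
  @enlarge (Delta_adm n k) (fun m _ => m = n.-1).

Lemma Delta_adm_prime_sub n k m (f : Delta_adm n k m) :
  @marked (Delta_adm_prime n k) m f -> @marked (Delta_adm_second n k) m f.
Proof.
case=> [|[m0 [g mg <-]]]; first by left.
by case: mg => [?|[_ e]]; [left | right].
Qed.

Definition Delta_adm_incl (n k : nat) :
  mshom (Delta_adm_prime n k) (Delta_adm_second n k) :=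
  enlarge_map (@Delta_adm_prime_sub n k).

Definition Delta3_eq : msset :=
  @enlarge (Delta 3) (fun m f =>
    [\/ m = 2, m = 3, vertices f = [:: 0; 2] | vertices f = [:: 1; 3]]).

Definition Delta3_sharp : msset := @enlarge (Delta 3) (fun _ _ => True).

Lemma Delta3_eq_sub m (f : Delta 3 m) :
  @marked Delta3_eq m f -> @marked Delta3_sharp m f.
Proof. by case=> [|[? _]]; [left | right]. Qed.

Definition Delta3_incl : mshom Delta3_eq Delta3_sharp :=
  enlarge_map Delta3_eq_sub.

(** * Join *)

(* The augmentation of X by a single simplex of degree -1; the index counts
   vertices, so [aug X k.+1] is [X k]. *)
Definition aug (X : sset) (k : nat) : Type := if k is k'.+1 then X k' else unit.

Lemma mono_n0 m (f : mono m.+1 0) : False.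
Proof. by case: (f ord0). Qed.

Definition aug_act (X : sset) m n : mono m n -> aug X n -> aug X m :=
  match m, n return mono m n -> aug X n -> aug X m with
  | 0, _ => fun _ _ => tt
  | m'.+1, 0 => fun f _ => False_rect _ (mono_n0 f)
  | m'.+1, n'.+1 => fun f x => act f x
  end.

Lemma aug_act_id (X : sset) n (x : aug X n) : aug_act (mono_id n) x = x.
Proof. by case: n x => [[]|n x] //=; apply: act_id. Qed.

Lemma aug_act_comp (X : sset) p m n (g : mono m n) (f : mono p m) (x : aug X n) :
  aug_act (mono_comp g f) x = aug_act f (aug_act g x).
Proof.
case: p m n g f x => [|p] [|m] [|n] g f x //=; try by case: (mono_n0 f).
- by case: (mono_n0 g).
- exact: act_comp.
Qed.

(* Simplices of the join with N vertices, that is, of dimension N-1: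
   the first [jk] vertices span [jx] in X, the last [jl] span [jy] in Y. *)
Record join_simplex (X Y : sset) (N : nat) := Join {
  jk : nat; jl : nat;
  jx : aug X jk; jy : aug Y jl;
  jE : jk + jl = N }.

Arguments Join {X Y N jk jl}.

(* A monotone map f with values in k + l vertices is the concatenation of a map
   with values in the first k vertices, defined on the first [cut f k]
   elements, and a map with values in the last l ones. *)
Definition cut m n (f : mono m n) (k : nat) : nat := #|[set i | f i < k]|.

Lemma cut_le m n (f : mono m n) k : cut f k <= m.
Proof. by rewrite -[leqRHS]card_ord max_card. Qed.

Lemma card_ord_lt m k : k <= m -> #|[set i : 'I_m | i < k]| = k.
Proof.
move=> km; have inj : injective (widen_ord km).
  by move=> a b /(congr1 val) ab; apply: val_inj.
rewrite -[RHS]card_ord -(card_imset _ inj).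
apply: eq_card => i; rewrite !inE; apply/idP/imsetP => [ik|[j _ ->]].
  by exists (Ordinal ik) => //; apply: val_inj.
exact: (ltn_ord j).
Qed.

Lemma lt_cut m n (f : mono m n) k (i : 'I_m) : (i < cut f k) = (f i < k).
Proof.
apply/idP/idP => h; last first.
  rewrite -(card_ord_lt (ltn_ord i)); apply: subset_leq_card.
  apply/subsetP => j; rewrite !inE ltnS => /(mono_le f) ji.
  exact: leq_ltn_trans ji h.
rewrite ltnNge; apply/negP => kf; move: h; rewrite ltnNge => /negP; apply.
rewrite -[leqRHS](card_ord_lt (ltnW (ltn_ord i))); apply: subset_leq_card.
apply/subsetP => j; rewrite !inE => jk; rewrite ltnNge; apply/negP => /(mono_le f).
by move=> /(leq_trans kf); rewrite leqNgt jk.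
Qed.

Lemma cut_uniq m n (f : mono m n) k c :
  c <= m -> (forall i : 'I_m, (i < c) = (f i < k)) -> cut f k = c.
Proof.
move=> cm h; rewrite -[RHS](card_ord_lt cm).
by apply: eq_card => i; rewrite !inE h.
Qed.

Section Split.
Variables (m n k l : nat) (f : mono m n) (E : k + l = n).

Lemma split_left_lt (i : 'I_(cut f k)) : f (widen_ord (cut_le f k) i) < k.
Proof. by rewrite -lt_cut /=. Qed.

Lemma split_left_subproof (i j : 'I_(cut f k)) :
  i <= j -> Ordinal (split_left_lt i) <= Ordinal (split_left_lt j).
Proof. by move=> ij /=; apply: mono_le. Qed.

Definition split_left : mono (cut f k) k := mk_mono split_left_subproof.

Lemma split_right_dom (i : 'I_(m - cut f k)) : cut f k + i < m.
Proof. by rewrite -ltn_subRL. Qed.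

Lemma split_right_lt (i : 'I_(m - cut f k)) :
  f (Ordinal (split_right_dom i)) - k < l.
Proof.
have h : k <= f (Ordinal (split_right_dom i)).
  by rewrite leqNgt -lt_cut /= -leqNgt leq_addr.
by rewrite ltn_subLR // E.
Qed.

Lemma split_right_subproof (i j : 'I_(m - cut f k)) :
  i <= j -> Ordinal (split_right_lt i) <= Ordinal (split_right_lt j).
Proof. by move=> ij /=; rewrite leq_sub2r //; apply: mono_le; rewrite /= leq_add2l. Qed.

Definition split_right : mono (m - cut f k) l := mk_mono split_right_subproof.

Lemma split_leftE (i : 'I_(cut f k)) (j : 'I_m) : i = j :> nat -> split_left i = f j :> nat.
Proof. by move=> e; rewrite mk_monoE /=; congr (nat_of_ord (f _)); apply: val_inj. Qed.

Lemma split_rightE (i : 'I_(m - cut f k)) (j : 'I_m) :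
  cut f k + i = j -> split_right i = f j - k :> nat.
Proof. by move=> e; rewrite mk_monoE /=; congr (nat_of_ord (f _) - k); apply: val_inj. Qed.

End Split.

Definition join_act (X Y : sset) m n (f : mono m n) (z : join_simplex X Y n) :
  join_simplex X Y m :=
  Join (aug_act (split_left (jk z) f) (jx z))
       (aug_act (split_right f (jE z)) (jy z))
       (subnKC (cut_le f (jk z))).

Lemma Join_eq (X Y : sset) N k l k1 l1 k2 l2 (x : aug X k) (y : aug Y l)
    (f1 : mono k1 k) (g1 : mono l1 l) (f2 : mono k2 k) (g2 : mono l2 l)
    (E1 : k1 + l1 = N) (E2 : k2 + l2 = N) :
  k1 = k2 ->
  (forall (i : 'I_k1) (j : 'I_k2), i = j :> nat -> f1 i = f2 j :> nat) ->
  (forall (i : 'I_l1) (j : 'I_l2), i = j :> nat -> g1 i = g2 j :> nat) ->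
  Join (aug_act f1 x) (aug_act g1 y) E1 = Join (aug_act f2 x) (aug_act g2 y) E2.
Proof.
move=> ek; subst k2; have el : l1 = l2 by apply/eqP; rewrite -(eqn_add2l k1) E1 E2.
subst l2 => hf hg.
have -> : f1 = f2 by apply: mono_eq => i; apply: hf.
have -> : g1 = g2 by apply: mono_eq => i; apply: hg.
by congr Join; apply: eq_irrelevance.
Qed.

(* The action of f on a join simplex, computed from any decomposition of f. *)
Lemma join_act_Join (X Y : sset) m n k l (f : mono m n) (x : aug X k) (y : aug Y l)
    (E : k + l = n) k' l' (g : mono k' k) (h : mono l' l) (E' : k' + l' = m) :
  (forall (i : 'I_k') (j : 'I_m), i = j :> nat -> g i = f j :> nat) ->
  (forall (i : 'I_l') (j : 'I_m), k' + i = j :> nat -> k + h i = f j :> nat) ->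
  join_act f (Join x y E) = Join (aug_act g x) (aug_act h y) E'.
Proof.
move=> hg hh.
have kk : k' <= m by rewrite -E' leq_addr.
have ck : cut f k = k'.
  apply: cut_uniq => // i; apply/idP/idP => ik.
    by rewrite -(hg (Ordinal ik) i erefl).
  rewrite ltnNge; apply/negP => ki; move: ik.
  have il : i - k' < l' by rewrite ltn_subLR // E'.
  by rewrite -(hh (Ordinal il) i) /= ?subnKC // ltnNge leq_addr.
apply: Join_eq => //= [i j ij|i j ij].
  have im : i < m by apply: leq_trans (cut_le f k); apply: ltn_ord.
  by rewrite (@split_leftE _ _ _ _ i (Ordinal im)) // (hg j (Ordinal im)).
have im := split_right_dom i.
rewrite (@split_rightE _ _ _ _ _ _ i (Ordinal im)) //.
have e : k' + j = cut f k + i by rewrite -ij; congr addn.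
by rewrite -(hh j (Ordinal im) e) addKn.
Qed.

Lemma join_act_id (X Y : sset) n (z : join_simplex X Y n) :
  join_act (mono_id n) z = z.
Proof.
case: z => k l x y E.
rewrite -[in RHS](aug_act_id x) -[in RHS](aug_act_id y).
by apply: join_act_Join => i j e; rewrite !mono_idE.
Qed.

Lemma join_act_comp (X Y : sset) p m n (g : mono m n) (f : mono p m)
    (z : join_simplex X Y n) :
  join_act (mono_comp g f) z = join_act f (join_act g z).
Proof.
case: z => k l x y E; rewrite [RHS]/join_act /= -!aug_act_comp.
apply: join_act_Join => i j e; rewrite !mono_compE.
  have fc : f j < cut g k by rewrite -lt_cut -e.
  by rewrite (@split_leftE _ _ _ _ _ (f j)) // (split_leftE e).
have fc : cut g k <= f j by rewrite leqNgt -lt_cut -e -leqNgt leq_addr.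
rewrite (@split_rightE _ _ _ _ _ _ _ (f j)) ?(split_rightE _ e) ?subnKC //.
by rewrite leqNgt -lt_cut -leqNgt.
Qed.

Definition join_sset (X Y : sset) : sset :=
  @SSet (fun n => join_simplex X Y n.+1) (fun m n f z => join_act f z)
    (fun n z => join_act_id z) (fun p m n g f z => join_act_comp g f z).

(* Faces and degeneracies act on the first component in the positions 0..k,
   and on the second one in the remaining positions. *)
Lemma join_face_left (X Y : sset) n k l (x : aug X k.+1) (y : aug Y l)
    (E : k.+1 + l = n.+1) (i : 'I_n.+1) (j : 'I_k.+1) (E' : k + l = n) :
  i = j :> nat ->
  join_act (coface i) (Join x y E) = Join (aug_act (coface j) x) y E'.
Proof.
move=> ij; rewrite -[in RHS](aug_act_id y); apply: join_act_Join => a b ab.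
  by rewrite !cofaceE ab ij.
rewrite mono_idE cofaceE ij /bump -ab.
by rewrite (leq_trans (ltnSE (ltn_ord j)) (leq_addr _ _)) addSn.
Qed.

Lemma join_face_right (X Y : sset) n k l (x : aug X k) (y : aug Y l.+1)
    (E : k + l.+1 = n.+1) (i : 'I_n.+1) (j : 'I_l.+1) (E' : k + l = n) :
  i = k + j :> nat ->
  join_act (coface i) (Join x y E) = Join x (aug_act (coface j) y) E'.
Proof.
move=> ij; rewrite -[in RHS](aug_act_id x); apply: join_act_Join => a b ab.
  rewrite mono_idE cofaceE ij /bump -ab leqNgt.
  by rewrite (leq_trans (ltn_ord a) (leq_addr _ _)).
by rewrite !cofaceE ij /bump -ab leq_add2l addnCA.
Qed.

Lemma join_degen_left (X Y : sset) n k l (x : aug X k) (y : aug Y l)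
    (E : k + l = n) (i : 'I_n) (j : 'I_k) (E' : k.+1 + l = n.+1) :
  i = j :> nat ->
  join_act (codegen i) (Join x y E) = Join (aug_act (codegen j) x) y E'.
Proof.
move=> ij; rewrite -[in RHS](aug_act_id y); apply: join_act_Join => a b ab.
  by rewrite !codegenE ab ij.
rewrite mono_idE codegenE ij /unbump -ab.
by rewrite (leq_trans (ltn_ord j)) /= ?subn1 // addSn ltnW // ltnS leq_addr.
Qed.

Lemma join_degen_right (X Y : sset) n k l (x : aug X k) (y : aug Y l)
    (E : k + l = n) (i : 'I_n) (j : 'I_l) (E' : k + l.+1 = n.+1) :
  i = k + j :> nat ->
  join_act (codegen i) (Join x y E) = Join x (aug_act (codegen j) y) E'.
Proof.
move=> ij; rewrite -[in RHS](aug_act_id x); apply: join_act_Join => a b ab.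
  rewrite mono_idE codegenE ij /unbump -ab ltnNge.
  by rewrite (leq_trans (ltnW (ltn_ord a)) (leq_addr _ _)) /= subn0.
rewrite !codegenE ij /unbump -ab ltn_add2l addnBA //.
by case: (ltnP j a) => // /(leq_ltn_trans _) ->.
Qed.

Definition aug_marked (X : msset) (k : nat) : aug X k -> Prop :=
  if k is k'.+1 then fun x => marked x else fun _ => False.

Definition join_marked (X Y : msset) n (z : join_sset X Y n) : Prop :=
  aug_marked (jx z) \/ aug_marked (jy z).

Program Definition join (X Y : msset) : msset :=
  @MSSet (join_sset X Y) (@join_marked X Y) _ _.
Next Obligation.
move=> X Y [//|n] z /= [i [[k l x y E] ->]]; rewrite /degen /=.
have [ik|ki] := ltnP i k.
  have E' : k.+1 + l = n.+2 by rewrite addSn E.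
  rewrite (@join_degen_left _ _ _ _ _ x y E i (Ordinal ik) E') //; left; rewrite /=.
  clear E E'.
  case: k x ik => // k x ik /=.
  by apply: marked_degenerate; exists (Ordinal ik), x.
have il : i - k < l by rewrite ltn_subLR // E.
have E' : k + l.+1 = n.+2 by rewrite addnS E.
rewrite (@join_degen_right _ _ _ _ _ x y E i (Ordinal il) E') /= ?subnKC //; right; rewrite /=.
clear E E'.
case: l y il => // l y il /=.
by apply: marked_degenerate; exists (Ordinal il), y.
Qed.
Next Obligation.
move=> X Y [[|[|k]] [|[|l]] x y //= E] [] //= h; exact: marked_pos h.
Qed.

Definition aug_map (X Y : msset) (f : mshom X Y) k : aug X k -> aug Y k :=
  if k is k'.+1 then f k' else id.

Lemma aug_map_act (X Y : msset) (f : mshom X Y) m n (g : mono m n) (x : aug X n) :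
  aug_map f (aug_act g x) = aug_act g (aug_map f x).
Proof.
case: m n g x => [|m] [|n] g x //=; first by case: (mono_n0 g).
exact: mshom_act.
Qed.

Program Definition join_map (X X' Y Y' : msset) (f : mshom X X') (g : mshom Y Y') :
  mshom (join X Y) (join X' Y') :=
  @MSHom (join X Y) (join X' Y')
    (fun n z => Join (aug_map f (jx z)) (aug_map g (jy z)) (jE z)) _ _.
Next Obligation.
by move=> X X' Y Y' f g m n h z; rewrite /= /join_act /= !aug_map_act.
Qed.
Next Obligation.
move=> X X' Y Y' f g n [k l x y E] /= [h|h]; [left|right]; rewrite /= in h *; clear E.
  by case: k x h => // k x; apply: mshom_marked.
by case: l y h => // l y; apply: mshom_marked.
Qed.

(** * Saturated complicial sets *)

Definition has_rlp (A B : msset) (i : mshom A B) (X : msset) : Prop :=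
  forall u : mshom A X, exists v : mshom B X, mshom_comp v i = u.

Record saturated_complicial (X : msset) : Prop := {
  rlp_horn : forall m k, 1 <= m -> k <= m -> has_rlp (horn_incl m k) X;
  rlp_thin : forall m k, 2 <= m -> k <= m -> has_rlp (Delta_adm_incl m k) X;
  (* [simplex N] is Delta[N-1], so this covers Delta[m] for all m >= -1 *)
  rlp_saturation : forall N,
    has_rlp (join_map (mshom_id (simplex N)) Delta3_incl) X }.

(** * Pointed objects and the loop space *)

Record pmsset := PMSSet {
  pmsset_msset :> msset;
  base : pmsset_msset 0 }.

Lemma mono_const_subproof m n (i j : 'I_m) : i <= j -> @ord0 n <= @ord0 n.
Proof. by []. Qed.

(* The unique map [m] -> [0]. *)
Definition mono_const m : mono m 1 := mk_mono (@mono_const_subproof m 0).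

Lemma mono_const_uniq m (f : mono m 1) : f = mono_const m.
Proof. by apply: mono_eq => i; rewrite [f i]ord1 [mono_const m i]ord1. Qed.

(* The degenerate n-simplex on the vertex x. *)
Definition const_simplex (X : sset) (x : X 0) n : X n := act (mono_const n.+1) x.

Lemma act_const (X : sset) (x : X 0) m n (f : mono m.+1 n.+1) :
  act f (const_simplex x n) = const_simplex x m.
Proof. by rewrite -act_comp [mono_comp _ _]mono_const_uniq. Qed.

Lemma const_marked (X : msset) (x : X 0) n : marked (const_simplex x n.+1).
Proof.
apply: marked_degenerate; exists ord0, (const_simplex x n).
by rewrite /degen act_const.
Qed.

Lemma Delta0_const n (t : Delta 0 n) :
  t = const_simplex (mono_id 1 : Delta 0 0) n.
Proof. by rewrite [t]mono_const_uniq [RHS]mono_const_uniq. Qed.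

(* The map Delta[0] -> X, and more generally W -> X, constant at x. *)
Program Definition const_map (W X : msset) (x : X 0) : mshom W X :=
  @MSHom W X (fun n _ => const_simplex x n) _ _.
Next Obligation. by move=> W X x m n f w; rewrite act_const. Qed.
Next Obligation.
move=> W X x [|n] w; first by move/marked_pos.
by move=> _; apply: const_marked.
Qed.

(* The map Delta[m] -> Delta[n] induced by f : [m] -> [n]. *)
Program Definition Delta_map m n (f : mono m.+1 n.+1) : mshom (Delta m) (Delta n) :=
  @MSHom (Delta m) (Delta n) (fun p x => mono_comp f x) _ _.
Next Obligation. by move=> m n f p q h x /=; rewrite mono_compA. Qed.
Next Obligation.
move=> m n f [//|p] x /= [i [y ->]]; exists i, (mono_comp f y).
by rewrite /degen /= mono_compA.
Qed.

(* The degeneracy Delta[n+1] -> Delta[n], as a map on Delta[n+1]_t. *)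
Program Definition Delta_t_codegen n (i : 'I_n.+1) : mshom (Delta_t n.+1) (Delta n) :=
  @MSHom (Delta_t n.+1) (Delta n) (fun p x => mono_comp (codegen i) x) _ _.
Next Obligation. by move=> n i p q h x /=; rewrite mono_compA. Qed.
Next Obligation.
move=> n i p x [h|[_ h]]; first exact: (@mshom_marked _ _ (Delta_map (codegen i)) p x h).
have e : p = n.+1.
  by apply/eqP; rewrite -eqSS -(size_iota 0 n.+2) -h size_map size_enum_ord.
subst p; exists i, (mono_id n.+1 : Delta n n).
rewrite /degen /= mono_comp1f; apply: mono_eq => j; rewrite mono_compE.
by congr (nat_of_ord (codegen i _)); apply: val_inj; rewrite /= -vertices_nth h nth_iota.
Qed.

Section PathSpace.
Variables (Z : msset) (a : Z 0).

(* The vertex of Delta[0] in Delta[0] * Delta[n]. *)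
Definition cone_vertex n : join (Delta 0) (Delta n) 0 :=
  @Join (Delta 0) (Delta n) 1 1 0 (mono_id 1) tt erefl.

(* The simplex Id_[n] of Delta[n] in Delta[0] * Delta[n]. *)
Definition cone_base n : join (Delta 0) (Delta n) n :=
  @Join (Delta 0) (Delta n) n.+1 0 n.+1 tt (mono_id n.+1) erefl.

Definition cone_map m n (f : mono m.+1 n.+1) :
  mshom (join (Delta 0) (Delta m)) (join (Delta 0) (Delta n)) :=
  join_map (mshom_id (Delta 0)) (Delta_map f).

Definition cone_path n : Type :=
  {p : mshom (join (Delta 0) (Delta n)) Z | p 0 (cone_vertex n) = a}.

Lemma path_act_subproof m n (f : mono m.+1 n.+1) (p : cone_path n) :
  mshom_comp (sval p) (cone_map f) 0 (cone_vertex m) = a.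
Proof. by case: p => p /= <-. Qed.

Definition path_act m n (f : mono m.+1 n.+1) (p : cone_path n) : cone_path m :=
  exist _ (mshom_comp (sval p) (cone_map f)) (path_act_subproof f p).

Program Definition path_sset : sset := @SSet cone_path path_act _ _.
Next Obligation.
move=> n [p ap]; apply: eq_exist; apply: mshom_eq => q [k l x y E] /=.
congr (p _ _); congr Join; first by case: k x {E}.
by case: l y {E} => [[]|l y] //=; rewrite mono_comp1f.
Qed.
Next Obligation.
move=> q m n g f [p ap]; apply: eq_exist; apply: mshom_eq => r [k l x y E] /=.
congr (p _ _); congr Join; first by case: k x {E}.
by case: l y {E} => [[]|l y] //=; rewrite mono_compA.
Qed.

(* p extends along Delta[0] * Delta[n] -> Delta[0] * Delta[n]_t; both have the
   same simplices. *)
Definition path_marked n (p : path_sset n) : Prop :=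
  1 <= n /\ exists q : mshom (join (Delta 0) (Delta_t n)) Z,
    forall m (z : join (Delta 0) (Delta n) m), q m z = sval p m z.

Program Definition path_space : msset := @MSSet path_sset path_marked _ _.
Next Obligation.
move=> [//|n] p [i [p' ->]]; split=> //.
exists (mshom_comp (sval p') (join_map (mshom_id (Delta 0)) (Delta_t_codegen i))).
by move=> m z.
Qed.
Next Obligation. by move=> p []. Qed.

Program Definition path_end : mshom path_space Z :=
  @MSHom path_space Z (fun n p => sval p n (cone_base n)) _ _.
Next Obligation.
move=> m n f [p ap] /=; rewrite -mshom_act; congr (p _ _).
rewrite /= (@join_act_Join _ _ _ _ _ _ f _ _ _ 0 m.+1 (mono_id 0) f erefl).
- by rewrite /= mono_compf1 mono_comp1f.
- by case.
- by move=> i j ij; congr (nat_of_ord (f _)); apply: val_inj.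
Qed.
Next Obligation.
move=> n [p ap] [n0 [q pq]] /=; rewrite -pq; apply: mshom_marked.
by right; right; rewrite /= vertices_id.
Qed.

End PathSpace.


Section Pullback.
Variables (A B C : msset) (f : mshom A C) (g : mshom B C).

Definition pullback_simplex n : Type := {z : A n * B n | f n z.1 = g n z.2}.

Lemma pullback_act_subproof m n (h : mono m.+1 n.+1) (z : pullback_simplex n) :
  f m (act h (sval z).1) = g m (act h (sval z).2).
Proof. by rewrite !mshom_act (svalP z). Qed.

Definition pullback_act m n (h : mono m.+1 n.+1) (z : pullback_simplex n) :
  pullback_simplex m :=
  exist _ (act h (sval z).1, act h (sval z).2) (pullback_act_subproof h z).

Program Definition pullback_sset : sset := @SSet pullback_simplex pullback_act _ _.
Next Obligation. by move=> n [[x y] e]; apply: eq_exist; rewrite /= !act_id. Qed.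
Next Obligation.
by move=> p m n h k [[x y] e]; apply: eq_exist; rewrite /= !act_comp.
Qed.

Program Definition pullback : msset :=
  @MSSet pullback_sset (fun n z => marked (sval z).1 /\ marked (sval z).2) _ _.
Next Obligation.
move=> [//|n] z [i [z' ->]] /=; split; apply: marked_degenerate.
  by exists i, (sval z').1.
by exists i, (sval z').2.
Qed.
Next Obligation. by move=> z [/marked_pos]. Qed.

End Pullback.

(* The pullback of Delta[0] -> Z <- path_space a, pointed by the constant map. *)
Program Definition Omega (Z : pmsset) : pmsset :=
  @PMSSet (pullback (const_map (Delta 0) (base Z)) (path_end (base Z)))
    (exist _ (mono_id 1, exist _ (const_map _ (base Z)) _) _).
Next Obligation.
move=> Z; rewrite /= -[RHS]act_id /const_simplex.
by rewrite (mono_const_uniq (mono_id 1)).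
Qed.
Next Obligation. by []. Qed.

(* The (n+1)-simplex of Z corresponding to an n-simplex of Omega Z: the image of
   the (n+1)-simplex (Id_[0], Id_[n]) of Delta[0] * Delta[n]. *)
Definition loop_simplex (Z : pmsset) n (p : Omega Z n) : Z n.+1 :=
  sval (sval p).2 n.+1
    (@Join (Delta 0) (Delta n) n.+2 1 n.+1 (mono_id 1) (mono_id n.+1) erefl).

(** * Homotopy monoids *)

Section Tau.
Variable X : pmsset.

Definition basept n : X n := const_simplex (base X) n.

Definition trivial_faces n : X n -> Prop :=
  if n is n'.+1 then fun z => forall i : 'I_n'.+2, face i z = basept n'
  else fun _ => True.

Definition sphere n : Type := {z : X n | trivial_faces z}.

Lemma basept_trivial_faces n : trivial_faces (basept n).
Proof. by case: n => [|n] //= i; apply: act_const. Qed.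

Definition sphere_base n : sphere n := exist _ (basept n) (basept_trivial_faces n).

(* The face d_i, with i a natural number (meaningful for i <= n+1). *)
Definition dface n (i : nat) (z : X n.+1) : X n := face (inord i) z.

Definition htpy n (alpha beta : sphere n) : Prop :=
  exists w : X n.+1, [/\ marked w, dface n w = sval alpha, dface n.+1 w = sval beta
    & forall i, i < n -> dface i w = basept n].

(* The quotient of [sphere n] by [htpy], an equivalence relation when X is
   saturated complicial, as the set of equivalence classes. *)
Definition tau n : Type := {A : sphere n -> Prop | exists alpha, A = htpy alpha}.

Definition tau_class n (alpha : sphere n) : tau n :=
  exist _ (htpy alpha) (ex_intro _ alpha erefl).

Definition tau_one n : tau n := tau_class (sphere_base n).

(* [theta] extends the horn defining the product of [alpha] and [beta], for
   n >= 1; n.-1 stands for n-1, and i.+1 < n for i <= n-2. *)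
Definition extends_product_horn n (alpha beta : sphere n)
    (theta : mshom (Delta_adm n.+1 n) X) : Prop :=
  let z := theta n.+1 (mono_id n.+2) in
  [/\ forall i, i.+1 < n -> dface i z = basept n, dface n.-1 z = sval alpha
    & dface n.+1 z = sval beta].

(* For n >= 1, [mul] is the product on tau_n: a b = [d_n theta]. *)
Definition is_tau_product n (mul : tau n -> tau n -> tau n) : Prop :=
  forall a b c : tau n, mul a b = c <->
    exists (alpha beta gamma : sphere n) (theta : mshom (Delta_adm n.+1 n) X),
      [/\ a = tau_class alpha, b = tau_class beta, c = tau_class gamma,
          extends_product_horn alpha beta theta
        & dface n (theta n.+1 (mono_id n.+2)) = sval gamma].

End Tau.

(* [mul] is transported from tau_1 X along the bijection [alpha] |-> [alpha],
   where a 1-simplex alpha is regarded as a 0-simplex p of Omega X. *)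
Definition is_transported_product (X : pmsset)
    (mul : Monoid.law (tau_one (Omega X) 0)) : Prop :=
  exists (mul1 : Monoid.law (tau_one X 1)) (phi : tau X 1 -> tau (Omega X) 0),
    [/\ is_tau_product mul1,
        bijective phi,
        forall (alpha : sphere X 1) (p : sphere (Omega X) 0),
          loop_simplex (sval p) = sval alpha ->
          phi (tau_class alpha) = tau_class p,
        phi (tau_one X 1) = tau_one (Omega X) 0
      & {morph phi : a b / mul1 a b >-> mul a b}].

Definition is_loop_product (X : pmsset) n :
    Monoid.law (tau_one (Omega X) n) -> Prop :=
  match n with
  | 0 => fun mul => is_transported_product mul
  | n'.+1 => fun mul => is_tau_product mul
  end.

Definition monoid_isomorphic (T U : Type) (e : T) (e' : U)
    (mul : Monoid.law e) (mul' : Monoid.law e') : Prop :=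
  exists f : T -> U,
    [/\ bijective f, f e = e' & {morph f : a b / mul a b >-> mul' a b}].

(* Main.v *)
Require Import Defs.
From HB Require Import structures.
From mathcomp Require Import all_boot zify boolp.

(** The isomorphism is induced by the shift of dimension.  As
    Delta[0] * Delta[n] is Delta[n+1], with only the degenerate simplices
    marked, an n-simplex of Omega X is an
    (n+1)-simplex of X whose initial vertex is the base point and whose 0-th
    face is constant ([loop_inj], [loop_surj]).  Faces are shifted by one
    ([loop_dface]), and a simplex of positive dimension is marked in Omega X
    exactly when the corresponding simplex is marked in X ([marked_loop]).

    Homotopy and product are instances of one relation: [cell a c b] says that
    some marked simplex has a, c, b as its last three faces, all others being
    constant.  Homotopy of c and b is [cell x c b] ([htpy_cell]).  For the
    product, an extension of the horn to Delta^n[n+1] is the same as such a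
    marked simplex, because every proper face of it that contains the vertices
    n-1, n, n+1 omits a vertex below n-1 and is therefore constant
    ([cell_theta]).  All other faces being constant, cells shift as well
    ([cell_loop]).  Hence the bijection of spheres descends to a bijection of
    tau_n (Omega X) with tau_(n+1) X which carries one product relation to the
    other, so that the monoid law of tau_(n+1) X can be transported and the
    law so obtained is the product of tau_n (Omega X).

    That the product is a well defined monoid law follows from filling
    tetrahedra: only the last four vertices of an (n+2)-simplex with constant
    low faces matter, its six edges being spheres and its four triangles cells
    ([tetrahedron]).  From three of the triangles one gets the fourth if that
    is opposite to one of the two middle vertices, or if it is opposite to the last
    vertex and the last edge is constant.  The first two cases are
    the two directions of associativity, the third one makes homotopy an
    equivalence relation and the product compatible with it. *)

Set Implicit Arguments.
Unset Strict Implicit.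
Unset Printing Implicit Defensive.

(** * Monotone maps *)

Lemma coface_inj n (i : 'I_n.+1) : injective (coface i).
Proof.
move=> a b /(congr1 val) /=; rewrite !cofaceE => e; apply: val_inj => /=.
by move: e; rewrite /bump; lia.
Qed.

Lemma coface_neq n (i : 'I_n.+1) (a : 'I_n) : coface i a <> i.
Proof. by move=> /(congr1 val) /=; rewrite cofaceE /bump; lia. Qed.

Lemma coface_monic p n (i : 'I_n.+1) (f g : mono p n) :
  mono_comp (coface i) f = mono_comp (coface i) g -> f = g.
Proof.
move=> e; apply: mono_eq => a; congr nat_of_ord; apply: (@coface_inj _ i).
by rewrite -!mono_compE e.
Qed.

Section Factor.
Variables (p n : nat) (j : 'I_n.+1) (f : mono p n.+1).
Hypothesis fj : forall a, f a <> j.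

Lemma coface_factor_lt a : unbump j (f a) < n.
Proof.
have : (f a : nat) <> j by move/val_inj/fj.
by rewrite /unbump; have := ltn_ord (f a); have := ltn_ord j; lia.
Qed.

Lemma coface_factor_mono (a b : 'I_p) :
  a <= b -> Ordinal (coface_factor_lt a) <= Ordinal (coface_factor_lt b).
Proof. by move/(mono_le f) => /=; rewrite /unbump; lia. Qed.

Lemma coface_factor : exists g : mono p n, f = mono_comp (coface j) g.
Proof.
exists (mk_mono coface_factor_mono); apply: mono_eq => a.
rewrite mono_compE cofaceE mk_monoE /= /unbump /bump.
have : (f a : nat) <> j by move/val_inj/fj.
by lia.
Qed.

End Factor.

Lemma coface_coface n (i j : nat) : i < j -> j <= n.+1 ->
  mono_comp (coface (inord j : 'I_n.+2)) (coface (inord i : 'I_n.+1)) =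
  mono_comp (coface (inord i)) (coface (inord j.-1)).
Proof.
move=> ij jn; apply: mono_eq => a; rewrite !mono_compE !cofaceE !inordK; try lia.
by rewrite /bump; lia.
Qed.

(** If a < b have the same image then so do a and a+1, and f factors through the
    degeneracy that identifies these two. *)
Lemma degenerate_act (X : sset) p n (f : mono p.+1 n.+1) (a b : 'I_p.+1) (z : X n) :
  a <> b -> f a = f b -> degenerate (act f z).
Proof.
wlog ab : a b / a < b.
  move=> h ne e; have : (a : nat) <> b by move/val_inj.
  by case: (ltngtP a b) => // c _; [apply: (h a b) | apply: (h b a) => // /esym].
move=> _ e; case: p => [|p] in f a b ab e *.
  by have := ltn_ord b; lia.
have ap : a < p.+1 by have := ltn_ord b; lia.
exists (Ordinal ap), (act (mono_comp f (coface a)) z).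
rewrite /degen -!act_comp; congr act; apply: mono_eq => c.
rewrite !mono_compE.
have [ca|ca] := eqVneq (c : nat) a.
  have -> : coface a (codegen (Ordinal ap) c) = inord a.+1.
    by apply: ord_inj; rewrite cofaceE codegenE ca inordK /bump /unbump /=; lia.
  have -> : c = a by apply: val_inj.
  apply/eqP; rewrite eqn_leq; apply/andP; split; first by apply: mono_le; rewrite inordK; lia.
  by rewrite [leqRHS]/= e; apply: mono_le; rewrite inordK; lia.
congr (nat_of_ord (f _)); apply: ord_inj.
by rewrite cofaceE codegenE /= /bump /unbump; lia.
Qed.

Lemma degenerate_repeats N p (f : simplex_sset N p) :
  degenerate f -> exists a b : 'I_p.+1, a <> b /\ (f : mono _ _) a = (f : mono _ _) b.
Proof.
case: p f => [//|p] f [i [y ->]]; exists (inord i), (inord i.+1); split.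
  by move/(congr1 val); rewrite /= !inordK; have := ltn_ord i; lia.
rewrite !mono_compE; congr (y _); apply: ord_inj.
by rewrite !codegenE !inordK /unbump; have := ltn_ord i; lia.
Qed.

(** By injectivity exactly k elements have an image below k, for every k. *)
Lemma mono_inj_id n (f : mono n n) : injective f -> f = mono_id n.
Proof.
move=> inj; have cutE k : k <= n -> cut f k = k.
  move=> kn; rewrite -[RHS](card_ord_lt kn) /cut.
  have -> : [set i | f i < k] = f @^-1: [set i : 'I_n | i < k].
    by apply/setP => i; rewrite !inE.
  by rewrite on_card_preimset //; apply: onW_bij; apply: injF_bij.
apply: mono_eq => i; rewrite mono_idE.
have := lt_cut f i.+1 i; have := lt_cut f i i.
by rewrite (cutE _ (ltn_ord i)) (cutE _ (ltnW (ltn_ord i))); lia.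
Qed.

(** Either f identifies two vertices, and the result is degenerate, or f is an
    identity. *)
Lemma marked_act_surj (X : msset) p n (f : mono p.+1 n.+1) (z : X n) :
  (forall j, exists i, f i = j) -> marked z -> marked (act f z).
Proof.
move=> surj mz; have [inj|] := boolP (injectiveb f); last first.
  move=> /injectivePn[a [b ab fab]].
  by apply: marked_degenerate; apply: (degenerate_act (a := a) (b := b)) => //; apply/eqP.
have inj' := injectiveP _ inj.
have e : p = n.
  apply/eqP; rewrite -eqSS -[p.+1]card_ord -[n.+1]card_ord eqn_leq; apply/andP; split.
    exact: leq_card inj'.
  rewrite -[leqRHS](card_codom inj'); apply: subset_leq_card; apply/subsetP => j _.
  by have [i <-] := surj j; apply: codom_f.
by subst p; rewrite (mono_inj_id inj') act_id.
Qed.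

(** * Admissible simplices *)

Definition hits_window p m k (f : mono p.+1 m.+1) : Prop :=
  forall j : 'I_m.+1, k.-1 <= j <= k.+1 -> exists i, f i = j.

(** By the Yoneda lemma these are the m-simplices of X that are the image of the
    top simplex under a map from Delta^k[m]; see [adm_map] and
    [adm_top_admissible]. *)
Definition admissible (X : msset) m k (z : X m) : Prop :=
  forall p (f : mono p.+1 m.+1), 0 < p -> hits_window k f -> marked (act f z).

Lemma admissible_marked (X : msset) m k (z : X m) :
  0 < m -> admissible k z -> marked z.
Proof.
move=> m0 /(_ m (mono_id _) m0); rewrite act_id; apply => j _; exists j; exact: mono_idE.
Qed.

Section AdmMap.
Variables (X : msset) (m k : nat) (z : X m).
Hypothesis hz : admissible k z.

Lemma adm_map_act p q (f : mono p.+1 q.+1) (g : Delta_adm m k q) :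
  act (act f g : mono _ _) z = act f (act (g : mono _ _) z).
Proof. exact: act_comp. Qed.

Lemma adm_map_marked p (g : Delta_adm m k p) : marked g -> marked (act (g : mono _ _) z).
Proof.
case=> [/degenerate_repeats[a [b [ab gab]]]|[p0 hg]]; last exact: hz.
by apply: marked_degenerate; apply: degenerate_act gab.
Qed.

Definition adm_map : mshom (Delta_adm m k) X :=
  @MSHom (Delta_adm m k) X (fun p g => act (g : mono _ _) z) adm_map_act adm_map_marked.
End AdmMap.

Lemma adm_top (X : msset) m k (theta : mshom (Delta_adm m k) X) p (f : Delta_adm m k p) :
  theta p f = act (f : mono _ _) (theta m (mono_id m.+1)).
Proof. by rewrite -mshom_act /= mono_comp1f. Qed.

Lemma adm_top_admissible (X : msset) m k (theta : mshom (Delta_adm m k) X) :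
  admissible k (theta m (mono_id m.+1)).
Proof. by move=> p f p0 hf; rewrite -adm_top; apply: mshom_marked; right. Qed.

(** A map on the horn is a family of faces that agree wherever two of them meet.
    A simplex of the horn is sent to the restriction of the face [t i] for any
    i that it omits; compatibility makes the choice of i irrelevant. *)
Lemma horn_extension (X : msset) m k (t : 'I_m.+2 -> X m) :
  has_rlp (horn_incl m.+1 k) X ->
  (forall (i j : 'I_m.+2) p (f g : mono p.+1 m.+1), i <> k :> nat -> j <> k :> nat ->
     mono_comp (coface i) f = mono_comp (coface j) g -> act f (t i) = act g (t j)) ->
  (forall (i : 'I_m.+2) p (f : mono p.+1 m.+1), i <> k :> nat -> 0 < p ->
     hits_window k (mono_comp (coface i) f) -> marked (act f (t i))) ->
  exists2 z : X m.+1, admissible k z & forall i : 'I_m.+2, i <> k :> nat -> face i z = t i.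
Proof.
move=> rlp compat mk.
have lift p (g : horn m.+1 k p) :
    exists y : X p, forall (i : 'I_m.+2) (f : mono p.+1 m.+1), i <> k :> nat ->
      (sval g : mono _ _) = mono_comp (coface i) f -> y = act f (t i).
  have [j [jk /coface_factor[f ef]]] := svalP g.
  exists (act f (t j)) => i f' ik ef'; apply: compat => //; by rewrite -ef -ef'.
pose u p (g : horn m.+1 k p) : X p := sval (cid (lift p g)).
have uE p (g : horn m.+1 k p) (i : 'I_m.+2) (f : mono p.+1 m.+1) : i <> k :> nat ->
    (sval g : mono _ _) = mono_comp (coface i) f -> u p g = act f (t i).
  by rewrite /u; case: cid => y /= h; apply: h.
have u_act p q (h : mono p.+1 q.+1) (g : horn m.+1 k q) : u p (act h g) = act h (u q g).
  have [j [jk /coface_factor[f ef]]] := svalP g.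
  rewrite (uE _ g j f) // (uE _ _ j (mono_comp f h)) ?act_comp //=.
  by rewrite mono_compA ef.
have u_marked p (g : horn m.+1 k p) : marked g -> marked (u p g).
  have [j [jk /coface_factor[f ef]]] := svalP g.
  rewrite (uE _ g j f) // => -[/degenerate_repeats[a [b [ab gab]]]|[p0 hg]].
    apply: marked_degenerate; apply: (degenerate_act (a := a) (b := b)) => //.
    by apply: (@coface_inj _ j); rewrite -!mono_compE -ef.
  by apply: mk => //; rewrite -ef.
have [v hv] := rlp (MSHom u_act u_marked).
exists (v m.+1 (mono_id m.+2)); first exact: adm_top_admissible.
move=> i ik; rewrite /face -adm_top.
have hi : @in_horn m.+1 k m (coface i) by exists i; split=> // a; apply: coface_neq.
pose g : horn m.+1 k m := exist (@in_horn m.+1 k m) (coface i) hi.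
have := congr1 (fun w : mshom (horn m.+1 k) X => w m g) hv.
rewrite /= => ->; rewrite (uE _ _ i (mono_id _)) ?act_id //=.
by rewrite mono_compf1.
Qed.

(** The simplices marked in Delta^k[m+1]' and not in Delta^k[m+1] are the faces other
    than the k-th, and Delta^k[m+1]'' marks in addition the k-th face. *)
Lemma thin_face (X : msset) m (k : 'I_m.+2) (z : X m.+1) : 0 < m ->
  has_rlp (Delta_adm_incl m.+1 k) X -> admissible k z ->
  (forall i : 'I_m.+2, i <> k :> nat -> marked (face i z)) -> marked (face k z).
Proof.
move=> m0 rlp hz mf.
have u_marked p (g : Delta_adm_prime m.+1 k p) :
    marked g -> marked (adm_map hz p g).
  case=> [|[p0 [h mh eh]]]; first exact: mshom_marked.
  case: mh => [mh|[_ ep]].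
    by rewrite -eh; apply: mshom_marked; apply: mshom_marked.
  (* A simplex of the horn of the dimension of a facet is a facet or degenerate. *)
  rewrite /= in ep; subst p.
  have [j [jk /coface_factor[f ef]]] := svalP h.
  rewrite -eh /= ef act_comp.
  have [inj|] := boolP (injectiveb f); last first.
    move=> /injectivePn[a [b ab fab]].
    by apply: marked_degenerate; apply: (degenerate_act (a := a) (b := b)) => //; apply/eqP.
  by rewrite (mono_inj_id (injectiveP _ inj)) act_id; apply: mf.
have [v hv] := rlp (@MSHom (Delta_adm_prime m.+1 k) X _ (mshom_act (adm_map hz)) u_marked).
have := congr1 (fun w : mshom (Delta_adm_prime m.+1 k) X => w m (coface k)) hv.
rewrite /= -/(face k z) => <-; apply: mshom_marked; right.
by split.
Qed.

(** * Horns with constant low faces *)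

Section Pointed.
Variable X : pmsset.

Lemma face_dface n (i : 'I_n.+2) (z : X n.+1) : face i z = dface i z.
Proof. by rewrite /dface inord_val. Qed.

Lemma dface_dface n i j (z : X n.+2) : i < j -> j <= n.+2 ->
  dface i (dface j z) = dface j.-1 (dface i z).
Proof. by move=> ij jn; rewrite /dface /face -!act_comp coface_coface. Qed.

Lemma dface_base n i : dface i (basept X n.+1) = basept X n.
Proof. exact: act_const. Qed.

Lemma trivial_facesP n (z : X n.+1) :
  trivial_faces z <-> forall i, i <= n.+1 -> dface i z = basept X n.
Proof.
by split=> h i; [move=> _; apply: h | rewrite face_dface; apply: h; rewrite -ltnS].
Qed.

(** A simplex of positive dimension that omits a vertex lies in a face, and
    constant simplices are marked. This reduces admissibility to the marking
    of the top simplex. *)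
Lemma marked_act_faces m p (z : X m.+1) (f : mono p.+1 m.+2) :
  0 < p -> marked z ->
  (forall j : 'I_m.+2, (forall a, f a <> j) -> dface j z = basept X m) -> marked (act f z).
Proof.
move=> p0 mz hz.
have [surj|] := pselect (forall j, exists i, f i = j); first exact: marked_act_surj.
move=> /existsNP[j /forallNP fj].
have [g ->] := coface_factor fj.
rewrite act_comp -/(face j z) face_dface hz // /basept act_const.
by rewrite -(prednK p0); apply: const_marked.
Qed.

(** The horn lifting property in terms of the simplicial identities. Only faces
    [t i] with i outside {k-1, k, k+1} contain simplices that must be marked;
    the third hypothesis forces this by making [t i] marked and constant on its
    own faces opposite to vertices outside {k-1, k, k+1}, in the numbering of
    the whole simplex, whence the [bump]. *)
Lemma horn_fill m k (t : nat -> X m.+1) :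
  has_rlp (horn_incl m.+2 k) X ->
  (forall i j, i < j -> j <= m.+2 -> i <> k -> j <> k ->
     dface i (t j) = dface j.-1 (t i)) ->
  (forall i, i <= m.+2 -> ~~ (k.-1 <= i <= k.+1) ->
     marked (t i) /\ forall j, j <= m.+1 -> ~~ (k.-1 <= bump i j <= k.+1) ->
       dface j (t i) = basept X m) ->
  exists2 z : X m.+2, admissible k z & forall i, i <= m.+2 -> i <> k -> dface i z = t i.
Proof.
move=> rlp compat mk.
have [|i p f ik p0 hf|z hz tz] := horn_extension (t := fun i : 'I_m.+3 => t i) rlp; last 1 first.
- exists z => // i im ik; rewrite /dface tz inordK //.
- move=> i j p f g.
  wlog ij : i j f g / i < j.
    move=> h ik jk e; case: (ltngtP i j) => [c|c|/val_inj c]; first exact: h.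
      by apply/esym/h.
    by subst j; rewrite (coface_monic e).
  move=> ik jk e.
  (* The common simplex omits both i < j: it lies in the codimension 2 face. *)
  have gi a : g a <> inord i.
    move=> /(congr1 val) /=; rewrite inordK; last by have := ltn_ord j; lia.
    move=> ga; have := congr1 (fun h : mono _ _ => h a : nat) e.
    by rewrite !mono_compE !cofaceE ga /bump; lia.
  have [h eh] := coface_factor gi.
  have ef : f = mono_comp (coface (inord j.-1)) h.
    apply: (@coface_monic _ _ i); rewrite e eh !mono_compA.
    by rewrite -[X in coface X]inord_val coface_coface ?inord_val // -ltnS.
  rewrite ef eh !act_comp; congr act.
  have := compat i j ij; rewrite /dface /face => <- //; first by rewrite -ltnS.
- have [iw|iw] := boolP (k.-1 <= i <= k.+1).
    by have [a] := hf i iw; rewrite mono_compE => /coface_neq.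
  have [mt ht] := mk i (ltn_ord i) iw.
  apply: marked_act_faces => // j fj; apply: ht; first by rewrite -ltnS.
  apply/negP => jw; have lt : bump i j < m.+3 by rewrite -cofaceE.
  have [a e] := hf (Ordinal lt) jw; apply: (fj a).
  by apply: (@coface_inj _ i); rewrite -mono_compE e; apply: ord_inj; rewrite cofaceE.
Qed.

(** * Cells *)

(** The prescribed i-th face of an (n+1)-simplex. For n = 0 there is no face d_(n-1),
    and [a] is ignored. *)
Definition tail_face n (a c b : X n) (i : nat) : X n :=
  if i.+1 == n then a else if i == n then c else if i == n.+1 then b else basept X n.

Section TailFace.
Variables (n : nat) (a c b : X n).

Lemma tail_face_mid : tail_face a c b n = c.
Proof. by rewrite /tail_face eqxx; case: eqP => //; lia. Qed.

Lemma tail_face_last : tail_face a c b n.+1 = b.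
Proof. by rewrite /tail_face eqxx; do 2?case: eqP => //; lia. Qed.

Lemma tail_face_low i : i.+1 < n -> tail_face a c b i = basept X n.
Proof. by rewrite /tail_face; do 3?case: eqP => //; lia. Qed.

Lemma tail_face_base i : i < n -> tail_face (basept X n) c b i = basept X n.
Proof. by rewrite /tail_face; do 3?case: eqP => //; lia. Qed.

End TailFace.

Lemma tail_face_first n (a c b : X n.+1) : tail_face a c b n = a.
Proof. by rewrite /tail_face eqxx. Qed.

(** For n >= 1, [cell a c b] means that c is a product of a and b. *)
Definition cell n (a c b : X n) : Prop :=
  exists2 w : X n.+1, marked w & forall i, i <= n.+1 -> dface i w = tail_face a c b i.

Lemma htpy_cell n (a b : sphere X n) :
  htpy a b <-> cell (basept X n) (sval a) (sval b).
Proof.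
split=> [[w [mw wn wn1 wi]]|[w mw hw]]; exists w => //.
  move=> i; rewrite leq_eqVlt => /predU1P[->|]; first by rewrite tail_face_last.
  by rewrite ltnS leq_eqVlt => /predU1P[->|il]; rewrite ?tail_face_mid // tail_face_base // wi.
split=> [//|||i il]; first by rewrite hw // tail_face_mid.
  by rewrite hw // tail_face_last.
by rewrite hw ?tail_face_base // ltnW // ltnW.
Qed.

(** A face containing the vertices d, d+1, d+2 is everything or omits a vertex
    below d, and then it is constant. *)
Lemma cell_admissible d (a c b : X d.+1) :
  cell a c b <-> exists2 w : X d.+2, admissible d.+1 w &
    forall i, i <= d.+2 -> dface i w = tail_face a c b i.
Proof.
split=> [[w mw hw]|[w aw hw]]; exists w => //; last exact: admissible_marked aw.
move=> p f p0 hf; apply: marked_act_faces => // j fj.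
have jd : j < d.
  rewrite ltnNge; apply/negP => dj.
  by have [|a0 /fj] := hf j; first by have := ltn_ord j; lia.
by rewrite hw ?tail_face_low //; lia.
Qed.

Lemma cell_theta d (a b c : sphere X d.+1) :
  (exists theta : mshom (Delta_adm d.+2 d.+1) X,
     extends_product_horn a b theta /\
     dface d.+1 (theta d.+2 (mono_id d.+3)) = sval c) <->
  cell (sval a) (sval c) (sval b).
Proof.
split=> [[theta [[hi ha hb] hc]]|/cell_admissible[w aw hw]].
  apply/cell_admissible; exists (theta d.+2 (mono_id d.+3)); first exact: adm_top_admissible.
  move=> i; rewrite leq_eqVlt => /predU1P[->|]; first by rewrite tail_face_last.
  rewrite ltnS leq_eqVlt => /predU1P[->|]; first by rewrite tail_face_mid.
  by rewrite ltnS leq_eqVlt => /predU1P[->|id]; rewrite ?tail_face_first // tail_face_low // hi.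
exists (adm_map aw); rewrite /extends_product_horn /= act_id; split; last first.
  by rewrite hw // tail_face_mid.
split=> [i id||].
- by rewrite hw ?tail_face_low //; lia.
- by rewrite hw ?tail_face_first //; lia.
- by rewrite hw ?tail_face_last.
Qed.

(** * Filling cells and tetrahedra *)

Lemma sphere_dface n (a : sphere X n.+1) i : i <= n.+1 -> dface i (sval a) = basept X n.
Proof. by case: a => a /= /trivial_facesP; apply. Qed.

Lemma dface_tail_face d (a c b : sphere X d.+1) i j : i <= d.+1 ->
  dface i (tail_face (sval a) (sval c) (sval b) j) = basept X d.
Proof.
move=> id; rewrite /tail_face; do 3!(case: ifP => _; first exact: sphere_dface).
exact: dface_base.
Qed.

Section Filling.
Hypothesis hX : saturated_complicial X.

(** The required horn has nothing but constant simplices to be marked. The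
    new face is a sphere because its faces are faces of the given ones. *)
Lemma cell_fill d (a b : sphere X d.+1) :
  exists c : sphere X d.+1, cell (sval a) (sval c) (sval b).
Proof.
pose x := sphere_base X d.+1.
have [|i j ij jd ni nj|i id iw|z az hz] :=
  @horn_fill d d.+1 (tail_face (sval a) (sval x) (sval b)).
- exact: rlp_horn.
- by rewrite !dface_tail_face //; lia.
- rewrite tail_face_low; last by lia.
  by split=> [|*]; [apply: const_marked | apply: dface_base].
have hc : trivial_faces (dface d.+1 z).
  apply/trivial_facesP => i id; have [lt|ge] := ltnP i d.+1.
    rewrite dface_dface // hz ?dface_tail_face //; lia.
  have -> : i = d.+1 by lia.
  by have := @dface_dface d d.+1 d.+2 z; rewrite /= => <- //; rewrite hz ?dface_tail_face //; lia.
exists (exist _ _ hc); apply/cell_admissible; exists z => // i id /=.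
have [->|ne] := eqVneq i d.+1; first by rewrite tail_face_mid.
by rewrite hz //; [rewrite /tail_face (negPf ne) | apply/eqP].
Qed.

(** Call 0, 1, 2, 3 the last four vertices of a (d+3)-simplex all of whose faces
    opposite to earlier vertices are constant. Then [eij] is the face spanned by the
    earlier vertices and i, j, and the face opposite to the vertex r of 0, 1, 2, 3
    has constant faces except for the three edges between the others. *)
Section Tetrahedron.
Variables (d : nat) (e01 e02 e03 e12 e13 e23 : sphere X d.+1).

Definition tri r : nat -> X d.+1 :=
  match r with
  | 0 => tail_face (sval e23) (sval e13) (sval e12)
  | 1 => tail_face (sval e23) (sval e03) (sval e02)
  | 2 => tail_face (sval e13) (sval e03) (sval e01)
  | _ => tail_face (sval e12) (sval e02) (sval e01)
  end.

Definition triangle r : Prop :=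
  exists2 w : X d.+2, marked w & forall i, i <= d.+2 -> dface i w = tri r i.

Lemma tri_low r i : i < d -> tri r i = basept X d.+1.
Proof. by move=> id; case: r => [|[|[|r]]]; apply: tail_face_low. Qed.

(** The faces opposite to r and to s share the edge that avoids r and s. *)
Lemma tri_edge r s : r < s -> s < 4 -> tri s (d + r) = tri r (d + s).-1.
Proof.
have E : [/\ d + 0 = d, d + 1 = d.+1, d + 2 = d.+2 & d + 3 = d.+3] by split; lia.
have [E0 E1 E2 E3] := E.
case: r => [|[|[|r]]]; case: s => [|[|[|[|s]]]] //= _ _;
  rewrite ?E0 ?E1 ?E2 ?E3 /= ?tail_face_first ?tail_face_mid ?tail_face_last //.
Qed.

(** For k = 1, 2 the three vertices around k span a triangle, all that has to be
    marked for the horn to be admissible, simplices without some earlier vertex being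
    constant. For k = 3, the last vertex, the edge 23
    has to be marked too, which holds if it is constant. The missing
    triangle is marked by [thin_face]. *)
Lemma tetrahedron k : 0 < k < 4 -> (k = 3 -> e23 = sphere_base X d.+1) ->
  (forall r, r < 4 -> r <> k -> triangle r) -> triangle k.
Proof.
move=> k4 k3 tris.
have /choice[W hW] : forall r, exists w : X d.+2, r < 4 -> r <> k ->
    marked w /\ forall i, i <= d.+2 -> dface i w = tri r i.
  move=> r; have [r4|r4] := ltnP r 4; last by exists (basept X _).
  have [->|/eqP rk] := eqVneq r k; first by exists (basept X _).
  by have [w mw hw] := tris r r4 rk; exists w.
(* [W r] is the triangle opposite to r, that is the face with index d + r. *)
pose t i := if i < d then basept X d.+2 else W (i - d).
have mt i : i <= d.+3 -> i <> d + k -> marked (t i).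
  move=> i3 ik; rewrite /t; case: ltnP => di; first exact: const_marked.
  by have [||//] := hW (i - d); lia.
have ft i j : i <= d.+3 -> i <> d + k -> j <= d.+2 ->
    dface j (t i) = if i < d then basept X d.+1 else tri (i - d) j.
  move=> i3 ik jd; rewrite /t; case: ltnP => di; first exact: dface_base.
  by have [||_ ->] // := hW (i - d); lia.
have [|i j ij jd ni nj|i id iw|z az hz] := @horn_fill d.+1 (d + k) t.
- apply: rlp_horn => //; lia.
- rewrite !ft //; try lia.
  case: (ltnP j d) => dj; first by rewrite (ltn_trans ij dj).
  case: (ltnP i d) => di; first by rewrite tri_low.
  have -> : j = d + (j - d) by lia.
  have {1}-> : i = d + (i - d) by lia.
  by rewrite [d + (j - d) - d]addKn tri_edge //; lia.
- split=> [|j jd jw]; first by apply: mt => //; lia.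
  rewrite ft //; try lia.
  case: (ltnP i d) => // di.
  have [jl|jl] := ltnP j d; first by rewrite tri_low.
  (* The remaining face in both triangles opposite to 0 and 1 is the edge 23. *)
  have [k_3 [-> i1]] : k = 3 /\ j = d /\ (i = d \/ i = d.+1).
    by move: jw iw; rewrite /bump; lia.
  have -> : basept X d.+1 = sval e23 by rewrite k3.
  by case: i1 => ->; rewrite ?subnn ?subSnn /= tail_face_first.
exists (dface (d + k) z).
  have kE : (inord (d + k) : 'I_d.+4) = d + k :> nat by rewrite inordK //; lia.
  apply: thin_face; rewrite ?kE //; first by apply: rlp_thin => //; lia.
  move=> i ik; have := ltn_ord i; rewrite ltnS => id.
  by rewrite face_dface hz //; apply: mt.
move=> i id; have [lt|ge] := ltnP i (d + k).
  rewrite dface_dface ?hz ?ft //; try lia.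
  case: ltnP => di; first by rewrite tri_low.
  have {2}-> : i = d + (i - d) by lia.
  by rewrite -tri_edge ?addnBA // 1?addKn //; lia.
have -> : dface i (dface (d + k) z) = dface (d + k) (dface i.+1 z).
  by rewrite [RHS]dface_dface // ltnS.
rewrite hz ?ft //; try lia.
case: ltnP => di; first by lia.
rewrite tri_edge; try lia.
by congr tri; lia.
Qed.

End Tetrahedron.

End Filling.
End Pointed.

(** * The homotopy monoids *)

Section TauMonoid.
Variable X : pmsset.

Definition composes n (a b c : sphere X n) : Prop := cell (sval a) (sval c) (sval b).

Lemma is_tau_productE d (mul : tau X d.+1 -> tau X d.+1 -> tau X d.+1) :
  is_tau_product mul <->
  forall A B C, mul A B = C <-> exists a b c,
    [/\ A = tau_class a, B = tau_class b, C = tau_class c & composes a b c].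
Proof.
have E A B C :
    (exists (a b c : sphere X d.+1) (theta : mshom (Delta_adm d.+2 d.+1) X),
      [/\ A = tau_class a, B = tau_class b, C = tau_class c,
          extends_product_horn a b theta
        & dface d.+1 (theta d.+2 (mono_id d.+3)) = sval c]) <->
    exists a b c,
      [/\ A = tau_class a, B = tau_class b, C = tau_class c & composes a b c].
  split=> [[a [b [c [theta [-> -> -> h1 h2]]]]]|[a [b [c [-> -> -> h]]]]]; exists a, b, c.
    by split=> //; apply/cell_theta; exists theta.
  by have /cell_theta[theta []] := h; exists theta.
by split=> h A B C; rewrite h E.
Qed.

Hypothesis hX : saturated_complicial X.
Variable d : nat.
Implicit Types a b c e : sphere X d.+1.
Local Notation one := (sphere_base X d.+1).

Lemma composes_assocl a b c ab bc abc :
  composes a b ab -> composes b c bc -> composes ab c abc -> composes a bc abc.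
Proof.
move=> h0 h3 h2; apply: (tetrahedron hX (k := 1) (e01 := c) (e12 := b) (e13 := ab)) => //.
by case=> [|[|[|[|]]]].
Qed.

Lemma composes_assocr a b c ab bc abc :
  composes a b ab -> composes b c bc -> composes a bc abc -> composes ab c abc.
Proof.
move=> h0 h3 h1; apply: (tetrahedron hX (k := 2) (e02 := bc) (e12 := b) (e23 := a)) => //.
by case=> [|[|[|[|]]]].
Qed.

(** In the tetrahedron the edge 23 is constant, so that by [htpy_composes] the
    hypotheses say that b' is homotopic to b and bc' to bc. *)
Lemma composes_cancel b b' c bc bc' :
  composes one b b' -> composes one bc bc' -> composes b' c bc' -> composes b c bc.
Proof.
move=> h0 h1 h2; apply: (tetrahedron hX (k := 3) (e03 := bc') (e13 := b') (e23 := one)) => //.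
by case=> [|[|[|[|]]]].
Qed.

Lemma dface_degen a (j : 'I_d.+2) i : i <= d.+2 ->
  dface i (degen j (sval a)) =
  if (i == j) || (i == j.+1) then sval a else basept X d.+1.
Proof.
move=> id; rewrite /dface /face /degen -act_comp.
have ci (c : 'I_d.+2) : codegen j (coface (inord i) c) = unbump j (bump i c) :> nat.
  by rewrite codegenE cofaceE inordK.
case: ifP => ij.
  rewrite -[RHS]act_id; congr act; apply: mono_eq => c.
  by rewrite mono_compE mono_idE ci /bump /unbump; lia.
pose i' : 'I_d.+2 := inord (if i < j then i else i.-1).
have i'E : i' = (if i < j then i else i.-1) :> nat.
  by rewrite inordK //; case: ifP; have := ltn_ord j; lia.
have [|g ->] := @coface_factor _ _ i' (mono_comp (codegen j) (coface (inord i))).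
  move=> c /(congr1 (@nat_of_ord _)); rewrite mono_compE ci i'E /bump /unbump.
  by case: (ltnP i j); lia.
rewrite act_comp -/(face i' _) face_dface sphere_dface ?act_const //.
by rewrite -ltnS.
Qed.

(** Witnessed by the last degeneracy of a. *)
Lemma composes_1l a : composes one a a.
Proof.
exists (degen ord_max (sval a)) => [|i id].
  by apply: marked_degenerate; exists ord_max, (sval a).
by rewrite dface_degen //= /tail_face; do 4?case: eqP => //=; lia.
Qed.

(** Witnessed by the last but one degeneracy of a. *)
Lemma composes_1r a : composes a one a.
Proof.
have dd : d < d.+2 by lia.
exists (degen (Ordinal dd) (sval a)) => [|i id].
  by apply: marked_degenerate; exists (Ordinal dd), (sval a).
by rewrite dface_degen //= /tail_face eqSS; do 4?case: eqP => //=; lia.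
Qed.

Lemma htpy_composes a b : htpy a b <-> composes one b a.
Proof. exact: htpy_cell. Qed.

(** With [htpy_refl] this gives symmetry and transitivity. *)
Lemma htpy_euclid a b c : htpy a b -> htpy a c -> htpy b c.
Proof.
rewrite !htpy_composes => hb hc.
exact: composes_cancel (composes_1l one) hb hc.
Qed.

Lemma htpy_refl a : htpy a a.
Proof. by rewrite htpy_composes; apply: composes_1l. Qed.

Lemma htpy_sym a b : htpy a b -> htpy b a.
Proof. by move=> h; apply: htpy_euclid h (htpy_refl a). Qed.

Lemma tau_classP a b : tau_class a = tau_class b <-> htpy a b.
Proof.
split=> [/(congr1 sval) /= ->|ab]; first exact: htpy_refl.
apply: eq_exist; apply/predeqP => c; split=> [|bc]; first exact: htpy_euclid.
by apply: htpy_euclid bc; apply: htpy_sym.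
Qed.

Lemma tau_class_surj (A : tau X d.+1) : exists a, A = tau_class a.
Proof. by case: A => A [a e]; exists a; apply: eq_exist. Qed.

(** Replacing a and c is [composes_cancel]; replacing b by b' is associativity for
    a', one and b'. *)
Lemma composes_htpy a a' b b' c c' : htpy a a' -> htpy b b' -> htpy c c' ->
  composes a b c -> composes a' b' c'.
Proof.
move=> aa bb cc abc.
have h : composes a' b c'.
  by apply: composes_cancel abc; apply/htpy_composes.
apply: composes_assocr (composes_1r a') _ h.
by apply/htpy_composes.
Qed.

(** Associativity for one, a and b. *)
Lemma composes_uniq a b c c' : composes a b c -> composes a b c' -> htpy c c'.
Proof.
move=> h h'; apply/htpy_composes.
exact: composes_assocl (composes_1l a) h' h.
Qed.

Definition tau_rep (A : tau X d.+1) := sval (cid (tau_class_surj A)).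

Lemma tau_repE A : tau_class (tau_rep A) = A.
Proof. by rewrite /tau_rep; case: cid. Qed.

Definition tau_mul (A B : tau X d.+1) : tau X d.+1 :=
  tau_class (sval (cid (cell_fill hX (tau_rep A) (tau_rep B)))).

Lemma tau_mul_class a b c :
  tau_mul (tau_class a) (tau_class b) = tau_class c <-> composes a b c.
Proof.
rewrite /tau_mul; case: cid => e /= abe; rewrite tau_classP.
have ha : htpy (tau_rep (tau_class a)) a by apply/tau_classP; apply: tau_repE.
have hb : htpy (tau_rep (tau_class b)) b by apply/tau_classP; apply: tau_repE.
split=> [ec|abc]; first exact: composes_htpy ec abe.
by apply: composes_uniq abc; apply: composes_htpy abe => //; apply: htpy_refl.
Qed.

Lemma tau_mulP : is_tau_product tau_mul.
Proof.
apply/is_tau_productE => A B C; split=> [|[a [b [c [-> -> -> h]]]]]; last exact/tau_mul_class.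
have [a ->] := tau_class_surj A; have [b ->] := tau_class_surj B; have [c ->] := tau_class_surj C.
by move=> /tau_mul_class h; exists a, b, c.
Qed.

Lemma tau_mulA : associative tau_mul.
Proof.
move=> A B C.
have [a ->] := tau_class_surj A; have [b ->] := tau_class_surj B; have [c ->] := tau_class_surj C.
have [ab hab] := tau_class_surj (tau_mul (tau_class a) (tau_class b)).
have [bc hbc] := tau_class_surj (tau_mul (tau_class b) (tau_class c)).
have [abc habc] := tau_class_surj (tau_mul (tau_class ab) (tau_class c)).
rewrite hab hbc habc; apply/tau_mul_class.
by apply: composes_assocl; apply/tau_mul_class; eassumption.
Qed.

Lemma tau_mul1l : left_id (tau_one X d.+1) tau_mul.
Proof. by move=> A; have [a ->] := tau_class_surj A; apply/tau_mul_class/composes_1l. Qed.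

Lemma tau_mul1r : right_id (tau_one X d.+1) tau_mul.
Proof. by move=> A; have [a ->] := tau_class_surj A; apply/tau_mul_class/composes_1r. Qed.

HB.instance Definition _ := Monoid.isLaw.Build (tau X d.+1) (tau_one X d.+1) tau_mul
  tau_mulA tau_mul1l tau_mul1r.

End TauMonoid.

(** * Simplices of the cone as monotone maps *)

Section ConeMono.
Variable n : nat.
Local Notation cone N := (join_simplex (simplex_sset 1) (simplex_sset n.+1) N).

Lemma no_ord0 (i : 'I_0) : False. Proof. by case: i. Qed.

Definition mono_empty N : mono 0 N :=
  @mk_mono 0 N (fun i => False_rect _ (no_ord0 i)) (fun i _ _ => False_rect _ (no_ord0 i)).

Definition aug_mono N l : aug (simplex_sset N) l -> mono l N :=
  if l is _.+1 then id else fun _ => mono_empty N.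

Lemma aug_mono_act N l l' (g : mono l' l) (y : aug (simplex_sset N) l) :
  aug_mono (aug_act g y) = mono_comp (aug_mono y) g.
Proof.
case: l' g => [|l'] g; first by apply: mono_eq => -[].
by case: l g y => [|l] g y //; case: (mono_n0 g).
Qed.

(** A simplex of Delta[0] * Delta[n] as a list of vertices of Delta[n+1]: the
    initial segment in Delta[0] goes to 0, the rest is shifted by 1. *)
Definition cone_fun N (z : cone N) (i : 'I_N) : 'I_n.+2 :=
  match fintype.split (cast_ord (esym (jE z)) i) with
  | inl _ => ord0
  | inr j => lift ord0 (aug_mono (jy z) j)
  end.

Lemma cone_fun_left N (z : cone N) (i : 'I_N) : i < jk z -> cone_fun z i = 0 :> nat.
Proof. by rewrite /cone_fun; case: splitP => //= j ->; lia. Qed.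

Lemma cone_fun_right N (z : cone N) (i : 'I_N) (j : 'I_(jl z)) :
  i = jk z + j :> nat -> cone_fun z i = (aug_mono (jy z) j).+1 :> nat.
Proof.
rewrite /cone_fun; case: splitP => /= j' -> => [|/addnI/val_inj-> //].
by have := ltn_ord j'; lia.
Qed.

Lemma cone_split N (z : cone N) (i : 'I_N) :
  i < jk z \/ exists j : 'I_(jl z), i = jk z + j :> nat.
Proof.
have [|ki] := ltnP i (jk z); [by left | right].
have il : i - jk z < jl z by have := jE z; have := ltn_ord i; lia.
by exists (Ordinal il); rewrite /= subnKC.
Qed.

Lemma cone_fun_mono N (z : cone N) (i j : 'I_N) : i <= j -> cone_fun z i <= cone_fun z j.
Proof.
move=> ij; have [ik|[i' ei]] := cone_split z i; first by rewrite cone_fun_left.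
have [jk|[j' ej]] := cone_split z j; first by lia.
by rewrite (cone_fun_right ei) (cone_fun_right ej) ltnS; apply: mono_le; lia.
Qed.

Definition cone_mono N (z : cone N) : mono N n.+2 := mk_mono (cone_fun_mono z).

Lemma cone_mono_left N (z : cone N) (i : 'I_N) : i < jk z -> cone_mono z i = 0 :> nat.
Proof. by rewrite mk_monoE; apply: cone_fun_left. Qed.

Lemma cone_mono_right N (z : cone N) (i : 'I_N) (j : 'I_(jl z)) :
  i = jk z + j :> nat -> cone_mono z i = (aug_mono (jy z) j).+1 :> nat.
Proof. by rewrite mk_monoE; apply: cone_fun_right. Qed.

Lemma cone_mono_act M N (f : mono M N) (z : cone N) :
  cone_mono (join_act f z) = mono_comp (cone_mono z) f.
Proof.
apply: mono_eq => i; rewrite mono_compE.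
have [ik|[j ij]] := cone_split (join_act f z) i.
  by rewrite cone_mono_left // cone_mono_left // -lt_cut.
rewrite (cone_mono_right ij) /= aug_mono_act mono_compE.
symmetry; apply: cone_mono_right.
rewrite (@split_rightE _ _ _ _ _ _ j i) // subnKC // leqNgt -lt_cut.
by move: ij => /= ->; rewrite ltnNge leq_addr.
Qed.

Definition cone_top : cone n.+2 :=
  @Join (simplex_sset 1) (simplex_sset n.+1) n.+2 1 n.+1 (mono_id 1) (mono_id n.+1) erefl.

(** [cone_mono] identifies Delta[0] * Delta[n] with Delta[n+1]; all simplices come
    from the top one. *)
Lemma cone_topE N (z : cone N) : z = join_act (cone_mono z) cone_top.
Proof.
case: z => k l x y E; set z := Join x y E.
rewrite (@join_act_Join _ _ _ _ _ _ (cone_mono z) _ _ _ k l (mono_const k) (aug_mono y) E).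
- rewrite /z; congr Join.
    case: k x {E z} => [[]|k x] //=.
    by rewrite [x]mono_const_uniq [RHS]mono_const_uniq.
  by case: l y {E z} => [[]|l y] //=; rewrite mono_comp1f.
- by move=> i j ij; rewrite (@cone_mono_left _ z) -?ij //= ord1.
- by move=> i j ij; rewrite (@cone_mono_right _ z j i) // -ij.
Qed.

Lemma cone_mono_top : cone_mono cone_top = mono_id n.+2.
Proof.
apply: mono_eq => i; rewrite mono_idE; have [ik|[j ij]] := cone_split cone_top i.
  by rewrite cone_mono_left //; move: ik => /=; lia.
by rewrite (cone_mono_right ij) ij /= mono_idE.
Qed.

Lemma cone_mono_base : cone_mono (cone_base n : cone n.+1) = coface ord0.
Proof.
apply: mono_eq => i; rewrite cofaceE.
by rewrite (@cone_mono_right _ (cone_base n : cone n.+1) i i) //= mono_idE.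
Qed.

Lemma cone_mono_vertex i : cone_mono (cone_vertex n : cone 1) i = 0 :> nat.
Proof. by rewrite cone_mono_left // ord1. Qed.

Lemma cone_mono_repeat N (z : cone N) :
  @aug_marked (flat (simplex_sset 1)) _ (jx z) \/ @aug_marked (simplex n.+1) _ (jy z) ->
  exists a b, a <> b /\ cone_mono z a = cone_mono z b.
Proof.
case: z => k l x y E /= [h|h].
  case: k x h E => //= k x /degenerate_repeats[a [b [ab _]]] E.
  have kN : k.+1 <= N by lia.
  exists (widen_ord kN a), (widen_ord kN b); split.
    by move=> /(congr1 val) /= /val_inj.
  by apply: ord_inj; rewrite !cone_mono_left //=.
case: l y h E => //= l y /degenerate_repeats[a [b [ab yab]]] E.
have kN (i : 'I_l.+1) : k + i < N by have := ltn_ord i; lia.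
exists (Ordinal (kN a)), (Ordinal (kN b)); split.
  by move=> /(congr1 val) /= /addnI/val_inj.
set z := Join _ _ _; apply: ord_inj.
by rewrite (@cone_mono_right _ z _ a) // (@cone_mono_right _ z _ b) //= yab.
Qed.

End ConeMono.

(** * Simplices of the loop space *)

Section Loop.
Variable Z : pmsset.
Local Notation OZ := (Omega Z).

(** A path is determined by its value on the top simplex of the cone. *)
Lemma loopE n (p : OZ n) m (w : join (Delta 0) (Delta n) m) :
  sval (sval p).2 m w = act (cone_mono w) (loop_simplex p).
Proof. by rewrite /loop_simplex -mshom_act {1}[w]cone_topE. Qed.

Lemma loop_inj n : injective (@loop_simplex Z n).
Proof.
move=> p q e; have e2 m w := etrans (loopE p w) (etrans (congr1 _ e) (esym (@loopE _ q m w))).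
case: p q e e2 => [[t [f hf]] /= hp] [[s [g hg]] /= hq] _ e2.
apply: eq_exist; congr pair; first by rewrite [t]mono_const_uniq [RHS]mono_const_uniq.
by apply: eq_exist; apply: mshom_eq.
Qed.

Definition initial_vertex n (z : Z n) : Z 0 :=
  act (mk_mono (fun (i j : 'I_1) _ => leqnn (@ord0 n))) z.

Lemma initial_vertex_cone n (z : Z n.+1) : initial_vertex z = act (cone_mono (cone_vertex n)) z.
Proof.
congr act; apply: mono_eq => i.
by rewrite mk_monoE cone_mono_vertex.
Qed.

Lemma initial_vertex_dface n i (z : Z n.+1) : 0 < i <= n.+1 ->
  initial_vertex (dface i z) = initial_vertex z.
Proof.
move=> /andP[i0 ile]; rewrite /initial_vertex /dface /face -act_comp; congr act.
by apply: mono_eq => a; rewrite mono_compE cofaceE !mk_monoE inordK // /bump /= leqNgt i0.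
Qed.

Lemma initial_vertex_base n : initial_vertex (basept Z n) = base Z.
Proof. by rewrite /initial_vertex /basept act_const -[RHS]act_id [mono_id 1]mono_const_uniq. Qed.

Lemma dface0_cone n (z : Z n.+1) : dface 0 z = act (cone_mono (cone_base n)) z.
Proof.
rewrite cone_mono_base /dface /face; congr (act (coface _) _).
by apply: val_inj; rewrite /= inordK.
Qed.

Lemma dface0_loop n (p : OZ n) : dface 0 (loop_simplex p) = basept Z n.
Proof. by rewrite dface0_cone -loopE; case: p => [[t f] /= <-]. Qed.

Lemma initial_vertex_loop n (p : OZ n) : initial_vertex (loop_simplex p) = base Z.
Proof. by rewrite initial_vertex_cone -loopE; case: p => [[t [f hf]] /= hp]. Qed.

Section OfLoop.
Variables (n : nat) (z : Z n.+1).
Hypotheses (z0 : dface 0 z = basept Z n) (za : initial_vertex z = base Z).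

Lemma loop_map_act p q (f : mono p.+1 q.+1) (w : join (Delta 0) (Delta n) q) :
  act (cone_mono (act f w)) z = act f (act (cone_mono w) z).
Proof. by rewrite -act_comp /= cone_mono_act. Qed.

Lemma loop_map_marked p (w : join (Delta 0) (Delta n) p) :
  marked w -> marked (act (cone_mono w) z).
Proof.
by move=> /cone_mono_repeat[a [b [ab e]]]; apply/marked_degenerate/(degenerate_act z ab e).
Qed.

Definition loop_map : mshom (join (Delta 0) (Delta n)) Z := MSHom loop_map_act loop_map_marked.

Lemma loop_map_vertex : loop_map 0 (cone_vertex n) = base Z.
Proof. by rewrite /= -initial_vertex_cone. Qed.

(** The two hypotheses are the constraints that define the path space and the pullback. *)
Lemma loop_surj : exists p : OZ n, loop_simplex p = z.
Proof.
have e : const_map (Delta 0) (base Z) n (mono_const n.+1) =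
    path_end (base Z) n (exist _ loop_map loop_map_vertex).
  by rewrite /= -dface0_cone z0.
exists (exist _ (mono_const n.+1, exist _ loop_map loop_map_vertex) e).
by rewrite /loop_simplex /= cone_mono_top act_id.
Qed.

End OfLoop.

Lemma loop_dface n (p : OZ n.+1) i : i <= n.+1 ->
  loop_simplex (dface i p) = dface i.+1 (loop_simplex p).
Proof.
move=> ile; rewrite {1}/loop_simplex /= loopE; congr act; apply: mono_eq => a.
set w := Join _ _ _; rewrite cofaceE !inordK //.
have [al|[j ej]] := cone_split w a.
  by rewrite (cone_mono_left al); move: al => /=; rewrite /bump; lia.
have -> : cone_mono w a = (coface (inord i) (j : 'I_n.+1)).+1 :> nat.
  by rewrite (cone_mono_right ej); congr (nat_of_ord _).+1; rewrite /w /aug_mono mono_compf1.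
by rewrite cofaceE inordK // ej /bump /=; lia.
Qed.

Lemma loop_base n : loop_simplex (basept OZ n) = basept Z n.+1.
Proof. by []. Qed.

(** Delta[0] * Delta[n+1]_t has more marked simplices than Delta[0] * Delta[n+1]:
    those whose part in Delta[n+1] is the top simplex. If the part in Delta[0] is empty,
    the image is the 0-th face of the loop, which is constant; if it is
    the vertex, the image is the loop itself; otherwise the simplex is
    degenerate. *)
Lemma marked_loop n (p : OZ n.+1) : marked p <-> marked (loop_simplex p).
Proof.
split=> [[_ [_ [q hq]]]|mz].
  rewrite /loop_simplex -hq; apply: mshom_marked; right; right.
  by split=> //; apply: vertices_id.
split; first by rewrite [(sval p).1]Delta0_const; apply: const_marked.
split=> //.
pose q m (w : join (Delta 0) (Delta_t n.+1) m) : Z m :=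
  act (cone_mono (w : join (Delta 0) (Delta n.+1) m)) (loop_simplex p).
have q_act l m (f : mono l.+1 m.+1) (w : join (Delta 0) (Delta_t n.+1) m) :
    q l (act f w) = act f (q m w).
  by rewrite /q -act_comp /= cone_mono_act.
suff q_marked m (w : join (Delta 0) (Delta_t n.+1) m) : marked w -> marked (q m w).
  by exists (MSHom q_act q_marked) => m w /=; rewrite loopE.
have rep (w' : join (Delta 0) (Delta n.+1) m) (a b : 'I_m.+1) :
    a <> b -> cone_mono w' a = cone_mono w' b ->
    marked (act (cone_mono w') (loop_simplex p)).
  by move=> ab e; apply/marked_degenerate/(degenerate_act _ ab e).
case: w => k [|l] x y E h; rewrite /q.
  have [|a [b [ab e]]] := @cone_mono_repeat n.+1 _ (Join x y E); last exact: rep e.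
  by case: h; left.
have [h'|[_ vy]] : (aug_marked x \/ @marked (Delta n.+1) l y) \/
    (0 < l /\ vertices (y : mono l.+1 n.+2) = iota 0 n.+2).
- by case: h => [|[]]; [left; left | left; right | right].
- pose w := Join x (y : aug (simplex_sset n.+2) l.+1) E.
  have [a [b [ab e]]] := @cone_mono_repeat n.+1 _ w h'.
  exact: rep e.
have el : l = n.+1.
  by apply/eqP; rewrite -eqSS -(size_iota 0 n.+2) -vy size_map size_enum_ord.
subst l; have ey : y = mono_id n.+2.
  apply: mono_eq => i; rewrite mono_idE -vertices_nth vy nth_iota //.
subst y; clear h; case: k x E => [|[|k]] x E.
- have em : m = n.+1 by move: E; lia.
  subst m; rewrite (eq_irrelevance E erefl); case: x {E} => //.
  rewrite -/(cone_base n.+1) -dface0_cone dface0_loop; exact: const_marked.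
- have em : m = n.+2 by move: E; lia.
  subst m; rewrite (eq_irrelevance E erefl) [x]mono_const_uniq -(mono_const_uniq (mono_id 1)).
  by rewrite -/(cone_top n.+1) cone_mono_top act_id.
have m1 : 1 < m.+1 by move: E; lia.
apply: (rep _ ord0 (Ordinal m1)) => //.
by apply: ord_inj; rewrite !cone_mono_left.
Qed.

End Loop.

(** * Homotopy classes of the loop space *)

Section LoopTau.
Variable Z : pmsset.
Local Notation OZ := (Omega Z).

Lemma initial_vertex_id (z : Z 0) : initial_vertex z = z.
Proof.
rewrite /initial_vertex -[RHS]act_id [mono_id 1]mono_const_uniq.
by rewrite [mk_mono _]mono_const_uniq.
Qed.

(** For n = 0 the left hand side is void, and the two faces of the 1-simplex
    are the base point because it is a loop. *)
Lemma loop_trivial_faces n (p : OZ n) :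
  trivial_faces p <-> trivial_faces (loop_simplex p).
Proof.
case: n p => [|n] p.
  split=> // _; apply/trivial_facesP => i ile.
  case: i ile => [_|[_|//]]; first exact: dface0_loop.
  rewrite -[LHS]initial_vertex_id initial_vertex_dface // initial_vertex_loop.
  by rewrite -(initial_vertex_base Z 0) initial_vertex_id.
rewrite !trivial_facesP; split=> h i ile; last first.
  by apply: loop_inj; rewrite loop_dface // h.
by case: i ile => [|i] ile; [apply: dface0_loop | rewrite -loop_dface // h].
Qed.

Definition loop_sphere n (p : sphere OZ n) : sphere Z n.+1 :=
  exist _ (loop_simplex (sval p)) (proj1 (loop_trivial_faces (sval p)) (svalP p)).

Lemma loop_sphere_surj n (a : sphere Z n.+1) : exists p : sphere OZ n, loop_sphere p = a.
Proof.
have a0 : dface 0 (sval a) = basept Z n by apply: sphere_dface.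
have av : initial_vertex (sval a) = base Z.
  rewrite -(@initial_vertex_dface _ _ n.+1) ?ltnSn // sphere_dface //.
  exact: initial_vertex_base.
have [p pa] := loop_surj a0 av.
have hp : trivial_faces p by apply/loop_trivial_faces; rewrite pa; apply: svalP.
by exists (exist _ p hp); case: a pa {a0 av} => a ha /= pa; apply: eq_exist.
Qed.

Lemma loop_tail_face n (p q r : OZ n) i :
  loop_simplex (tail_face p q r i) =
  tail_face (loop_simplex p) (loop_simplex q) (loop_simplex r) i.+1.
Proof. by rewrite /tail_face !eqSS; do 3!case: ifP => // _. Qed.

(** A cell in Omega Z has one face less than its image in Z; the additional 0-th
    face is constant. For n = 0 it is the face where a cell in Z shows [p], which is
    why [p] has to be constant in this case. *)
Lemma cell_loop n (p q r : OZ n) : 0 < n \/ p = basept OZ n ->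
  cell p q r <-> cell (loop_simplex p) (loop_simplex q) (loop_simplex r).
Proof.
move=> hp; have tail0 :
    tail_face (loop_simplex p) (loop_simplex q) (loop_simplex r) 0 = basept Z n.+1.
  case: hp => [n0|->]; first by rewrite tail_face_low.
  by rewrite loop_base tail_face_base.
split=> [[w mw hw]|[w mw hw]].
  exists (loop_simplex w) => [|[|i] ile]; first exact/marked_loop.
    by rewrite dface0_loop.
  by rewrite -loop_dface // hw // loop_tail_face.
have w0 : dface 0 w = basept Z n.+1 by rewrite hw.
have wv : initial_vertex w = base Z.
  rewrite -(@initial_vertex_dface _ _ n.+2) ?ltnSn // hw // tail_face_last.
  exact: initial_vertex_loop.
have [v vw] := loop_surj w0 wv; subst w.
exists v => [|i ile]; first exact/marked_loop.
by apply: loop_inj; rewrite loop_dface // hw // loop_tail_face.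
Qed.

Lemma htpy_loop n (p q : sphere OZ n) : htpy (loop_sphere p) (loop_sphere q) <-> htpy p q.
Proof. by rewrite !htpy_cell cell_loop; [rewrite loop_base | right]. Qed.

Lemma composes_loop n (p q r : sphere OZ n.+1) :
  composes (loop_sphere p) (loop_sphere q) (loop_sphere r) <-> composes p q r.
Proof. by rewrite /composes cell_loop; [|left]. Qed.

Lemma deloop_proof n (A : tau Z n.+1) :
  exists p, (fun q : sphere OZ n => sval A (loop_sphere q)) = htpy p.
Proof.
case: A => A [a /= ->]; have [p <-] := loop_sphere_surj a.
by exists p; apply/predeqP => q /=; apply: htpy_loop.
Qed.

(** Homotopy classes being sets of spheres, the bijection is the preimage under
    [loop_sphere], and its inverse [enloop] the image. *)
Definition deloop n (A : tau Z n.+1) : tau OZ n := exist _ _ (deloop_proof A).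

Lemma deloop_class n (p : sphere OZ n) : deloop (tau_class (loop_sphere p)) = tau_class p.
Proof. by apply: eq_exist; apply/predeqP => q /=; apply: htpy_loop. Qed.

Lemma deloop_one n : deloop (tau_one Z n.+1) = tau_one OZ n.
Proof. by rewrite -[RHS]deloop_class; congr (deloop (tau_class _)); apply: eq_exist. Qed.

Lemma enloop_proof n (B : tau OZ n) :
  exists a, (fun b : sphere Z n.+1 => exists2 p, loop_sphere p = b & sval B p) = htpy a.
Proof.
case: B => B [p /= ->]; exists (loop_sphere p); apply/predeqP => b.
have [q <-] := loop_sphere_surj b; rewrite htpy_loop.
split=> [[r rq]|pq]; last by exists q.
by rewrite /= -htpy_loop rq htpy_loop.
Qed.

Definition enloop n (B : tau OZ n) : tau Z n.+1 := exist _ _ (enloop_proof B).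

Lemma deloopK n : cancel (@deloop n) (@enloop n).
Proof.
case=> A hA; apply: eq_exist; apply/predeqP => a /=.
by split=> [[p <-]|Aa]; last by have [p pa] := loop_sphere_surj a; exists p; rewrite ?pa.
Qed.

Lemma enloopK n : cancel (@enloop n) (@deloop n).
Proof.
case=> B [p eB]; apply: eq_exist; apply/predeqP => q /=; rewrite eB.
split=> [[r rq]|pq]; last by exists q.
by rewrite -htpy_loop rq htpy_loop.
Qed.

End LoopTau.

Section Transport.
Variables (T U : Type) (e : T) (mul : Monoid.law e) (f : T -> U) (g : U -> T).
Hypotheses (fK : cancel f g) (gK : cancel g f).

Definition transport_mul a b := f (mul (g a) (g b)).
Lemma transport_mulA : associative transport_mul.
Proof. by move=> a b c; rewrite /transport_mul !fK Monoid.mulmA. Qed.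
Lemma transport_mul1l : left_id (f e) transport_mul.
Proof. by move=> a; rewrite /transport_mul fK Monoid.mul1m gK. Qed.
Lemma transport_mul1r : right_id (f e) transport_mul.
Proof. by move=> a; rewrite /transport_mul fK Monoid.mulm1 gK. Qed.
HB.instance Definition _ :=
  Monoid.isLaw.Build U (f e) transport_mul transport_mulA transport_mul1l transport_mul1r.
Definition transport_law : Monoid.law (f e) := transport_mul.
End Transport.

Lemma enloop_class (Z : pmsset) n (p : sphere (Omega Z) n) :
  enloop (tau_class p) = tau_class (loop_sphere p).
Proof. by rewrite -deloop_class deloopK. Qed.

Lemma is_tau_product_deloop (Z : pmsset) n (mul : tau Z n.+2 -> tau Z n.+2 -> tau Z n.+2) :
  is_tau_product mul ->
  is_tau_product (fun A B => deloop (mul (enloop A) (enloop B)) : tau (Omega Z) n.+1).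
Proof.
move=> /is_tau_productE hmul; apply/is_tau_productE => A B C.
split=> [e|[p [q [r [-> -> -> pqr]]]]]; last first.
  rewrite !enloop_class -deloop_class; congr deloop; apply/hmul.
  by exists (loop_sphere p), (loop_sphere q), (loop_sphere r); split=> //; apply/composes_loop.
have [|a [b [c]]] := iffLR (hmul (enloop A) (enloop B) (enloop C)).
  by rewrite -e deloopK.
have [p <-] := loop_sphere_surj a; have [q <-] := loop_sphere_surj b.
have [r <-] := loop_sphere_surj c; rewrite -!enloop_class => -[eA eB eC /composes_loop pqr].
by exists p, q, r; split=> //; apply: (can_inj (@enloopK Z _)).
Qed.

(** * The isomorphism *)

Theorem theorem1p2 (n : nat) (X : pmsset) (hX : saturated_complicial X) :
  exists (mul : Monoid.law (tau_one X n.+1))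
         (mul' : Monoid.law (tau_one (Omega X) n)),
    [/\ is_tau_product mul, is_loop_product mul'
      & monoid_isomorphic mul mul'].
Proof.
pose mul : Monoid.law (tau_one X n.+1) := @tau_mul X hX n.
have mulP : is_tau_product mul by apply: tau_mulP.
have [mul' mul'E] : exists mul' : Monoid.law (tau_one (Omega X) n),
    forall A B, mul' A B = deloop (mul (enloop A) (enloop B)).
  rewrite -(deloop_one X n).
  by exists (transport_law mul (@deloopK X n) (@enloopK X n)).
have bij : bijective (@deloop X n) by exists (@enloop X n); [apply: deloopK | apply: enloopK].
have morph : {morph @deloop X n : A B / mul A B >-> mul' A B}.
  by move=> A B; rewrite mul'E !deloopK.
exists mul, mul'; split=> //; last by exists (@deloop X n); split=> //; apply: deloop_one.
case: n mul mulP mul' mul'E bij morph => [|m] mul mulP mul' mul'E bij morph /=.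
  exists mul, (@deloop X 0); split=> // [a p pa|]; last exact: deloop_one.
  rewrite -deloop_class; congr (deloop (tau_class _)).
  by case: a pa => a ha /= pa; apply: eq_exist.
have -> : (mul' : _ -> _ -> _) = fun A B => deloop (mul (enloop A) (enloop B)).
  by apply/funext => A; apply/funext => B; apply: mul'E.
exact: is_tau_product_deloop.
Qed.
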